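(* Given an instance with goods and (possibly heterogeneous) quantiles with $m=kn$, a balanced allocation maximizing egalitarian social welfare among all balanced allocations can be computed in polynomial time.
   Context: There is a set $N$ of $n$ agents and a set $M$ of $m$ indivisible items. Each agent $i$ has a value $v_i(g)\ge 0$ for each item $g$ and a quantile $\tau_i\in[0,1]$. For a nonempty bundle $S\subseteq M$, order its items as $g_1,\dots,g_{|S|}$ with $v_i(g_1)\le\dots\le v_i(g_{|S|})$; then $v_i(S)=v_i(g_{\lceil \tau_i|S|\rceil})$ if $\tau_i>0$ and $v_i(S)=v_i(g_1)$ if $\tau_i=0$. An allocation is an $n$-partition $A=(A_1,\dots,A_n)$ of $M$; when $m=kn$ it is balanced if $|A_i|=k$ for all $i$. The egalitarian social welfare is $\mathrm{ESW}(A)=\min_{i\in N}v_i(A_i)$. *)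

(* Defs.v *)
From mathcomp Require Import all_boot all_order all_algebra.
From Stdlib Require Import BinNums BinNat.
Set Implicit Arguments. Unset Strict Implicit. Unset Printing Implicit Defensive.
Import Order.TTheory GRing.Theory Num.Theory.

(* Part 1: the fair-division model (values and quantiles are rational, *)
(* as needed for a finite input encoding).                             *)

Local Open Scope ring_scope.

(* An allocation (n-partition of the items 'I_m among agents 'I_n) is
   represented by the owner of each item; bundle A i = items owned by i. *)
Definition allocation (n m : nat) := {ffun 'I_m -> 'I_n}.

Definition bundle (n m : nat) (A : allocation n m) (i : 'I_n) : {set 'I_m} :=
  [set g | A g == i].

Definition balanced (n m k : nat) (A : allocation n m) : Prop :=
  forall i : 'I_n, #|bundle A i| = k.

Definition sorted_values (m : nat) (vi : 'I_m -> rat) (S : {set 'I_m}) : seq rat :=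
  sort <=%R [seq vi g | g in S].

(* Quantile value: v_i(g_{ceil(tau |S|)}) if tau > 0, v_i(g_1) if tau = 0
   (1-indexed, hence the .-1 for nth). *)
Definition qvalue (m : nat) (vi : 'I_m -> rat) (tau : rat) (S : {set 'I_m}) : rat :=
  let s := sorted_values vi S in
  if 0 < tau then nth 0 s (absz (Num.ceil (tau * #|S|%:R))).-1
  else nth 0 s 0.

(* Egalitarian social welfare: min_i v_i(A_i)  (for n > 0). *)
Definition ESW (n m : nat) (v : 'I_n -> 'I_m -> rat) (tau : 'I_n -> rat)
    (A : allocation n m) : rat :=
  let s := [seq qvalue (v i) (tau i) (bundle A i) | i <- enum 'I_n] in
  foldr Num.min (head 0 s) s.

Inductive sym := Blank | S0 | S1.
Inductive move := MoveL | MoveR | Stay.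

Record TM := {
  tm_state : finType;
  tm_start : tm_state;
  tm_halt : pred tm_state;
  tm_delta : tm_state -> sym -> tm_state * sym * move
}.

(* configuration: state, left part (reversed, nearest cell first),
   scanned symbol, right part; unlisted cells are blank. *)
Definition config (M : TM) := (tm_state M * seq sym * sym * seq sym)%type.

Definition tm_step (M : TM) (c : config M) : config M :=
  let: (q, l, h, r) := c in
  if @tm_halt M q then c else
  let: (q', w, mv) := @tm_delta M q h in
  match mv with
  | MoveL => match l with
             | [::] => (q', [::], Blank, w :: r)
             | x :: l' => (q', l', x, w :: r)
             end
  | MoveR => match r with
             | [::] => (q', w :: l, Blank, [::])
             | x :: r' => (q', w :: l, x, r')
             end
  | Stay => (q', l, w, r)
  end.

Definition sym_of_bool (b : bool) : sym := if b then S1 else S0.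

Definition tm_init (M : TM) (w : seq bool) : config M :=
  match map sym_of_bool w with
  | [::] => (@tm_start M, [::], Blank, [::])
  | x :: r => (@tm_start M, [::], x, r)
  end.

Definition tm_run (M : TM) (t : nat) (w : seq bool) : config M :=
  iter t (@tm_step M) (tm_init M w).

Fixpoint read_word (s : seq sym) : seq bool :=
  match s with
  | S0 :: s' => false :: read_word s'
  | S1 :: s' => true :: read_word s'
  | _ => [::]
  end.

(* M, started on input w, is in a halting state after t steps (i.e. halted
   within t steps, halting states being absorbing) with output o. *)
Definition tm_computes_within (M : TM) (t : nat) (w o : seq bool) : Prop :=
  let: (q, _, h, r) := tm_run M t w in
  @tm_halt M q /\ read_word (h :: r) = o.

Fixpoint pos_bits (p : positive) : seq bool :=
  match p with
  | xH => [:: true]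
  | xO p' => false :: pos_bits p'
  | xI p' => true :: pos_bits p'
  end.

Definition nat_bits (x : nat) : seq bool :=
  match N.of_nat x with N0 => [::] | Npos p => pos_bits p end.

(* self-delimiting field: each bit b becomes 1b, terminated by 00 *)
Definition field (f : seq bool) : seq bool :=
  flatten [seq [:: true; b] | b <- f] ++ [:: false; false].

Definition enc_nat (x : nat) : seq bool := field (nat_bits x).
Definition enc_int (z : int) : seq bool := field [:: z < 0] ++ enc_nat (absz z).
Definition enc_rat (x : rat) : seq bool := enc_int (numq x) ++ enc_int (denq x).

Definition enc_instance (n m k : nat) (v : 'I_n -> 'I_m -> rat)
    (tau : 'I_n -> rat) : seq bool :=
  enc_nat n ++ enc_nat m ++ enc_nat k
  ++ flatten [seq enc_rat (tau i) | i <- enum 'I_n]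
  ++ flatten [seq flatten [seq enc_rat (v i g) | g <- enum 'I_m] | i <- enum 'I_n].

Definition enc_alloc (n m : nat) (A : allocation n m) : seq bool :=
  flatten [seq enc_nat (A g) | g <- enum 'I_m].

(* Main.v *)
(* Agent i gets value at least x from a bundle of k goods iff, in increasing order
   of value, all but the first ceil(tau_i k) - 1 of them (all of them if
   tau_i = 0) are worth at least x.  Split agent i into k slots (i, j), j < k; slot
   (i, j) accepts only goods worth at least x to i if tau_i k <= j + 1, and every
   good otherwise.  Balanced allocations of welfare at least x then correspond to
   perfect matchings of slots with goods, and the optimal welfare is one of the
   values v_i(g).  For each candidate x, a matching is sought by an auction: an
   unmatched slot takes a cheapest acceptable good, evicting its owner, and raises
   its price by one.  If a perfect matching exists, no price exceeds m, so the
   auction ends within m^2 bids.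

   Polynomial time is obtained by writing this algorithm in a small language of
   expressions over binary trees whose only loop repeats its body N times, N being
   the input length.  Trees live in a heap of shared cells addressed by unary
   numbers, so each primitive operation allocates at most one cell and the running
   time is polynomial for syntactic reasons.  The heap machine runs on finitely
   many bit stacks, which are stored one after the other on the Turing tape. *)
Require Import Defs.
From Stdlib Require Import BinPos BinNat Nnat.
From mathcomp Require Import all_boot all_order all_algebra zify.
Set Implicit Arguments. Unset Strict Implicit. Unset Printing Implicit Defensive.
Import Order.TTheory GRing.Theory Num.Theory.

(** A loop that pairs a tree with itself makes it exponentially large, so tree sizes admit no bound
    that follows the syntax; only the number of operations does. This is why copying a tree must
    mean copying an address. Loops without an exit test have a price of their own: each body must
    idle once its work is done, and each function is correct only under the hypothesis that its fuel
    suffices. The fuel is N^2, obtained from two nested loops, so that it exceeds the m^2 bids of an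
    auction. An auction fits such loops because it repeats one local update and never searches for
    an augmenting path. Its price bound rests on slackness: a good costs its owner at most one more
    than any other good that the owner accepts. Comparing this with a fixed perfect matching leaves
    no room for a price above m. *)

Local Notation s_ := sym_of_bool.

(** * Machines with exit values and their composition *)

Record mach (X : Type) := Mach {
  mQ : finType;
  mstart : mQ;
  mdelta : mQ -> sym -> (mQ + X) * sym * move }.

Definition tape := (seq sym * seq sym)%type.

Definition tmove (w : sym) (mv : move) (tp : tape) : tape :=
  match mv with
  | MoveL => (behead tp.1, head Blank tp.1 :: w :: behead tp.2)
  | MoveR => (w :: tp.1, behead tp.2)
  | Stay => (tp.1, w :: behead tp.2)
  end.

Inductive mrun X (M : mach X) : mQ M -> tape -> nat -> X -> tape -> Prop :=
| mrun_exit q tp w mv x :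
    mdelta q (head Blank tp.2) = (inr x, w, mv) -> mrun q tp 1 x (tmove w mv tp)
| mrun_step q q' tp w mv t x tp' :
    mdelta q (head Blank tp.2) = (inl q', w, mv) ->
    mrun q' (tmove w mv tp) t x tp' -> mrun q tp t.+1 x tp'.

Definition runs X (M : mach X) := mrun (mstart M).

Definition act X (f : sym -> X * sym * move) : mach X :=
  @Mach X unit tt (fun _ h => let: (x, w, mv) := f h in (inr x, w, mv)).

(** The exit step of [M] leads directly into the start state of [K x], so running times add exactly.
    Finiteness of [X] keeps the tagged sum of state spaces finite. *)
Definition mbind (X : finType) Y (M : mach X) (K : X -> mach Y) : mach Y :=
  @Mach Y (mQ M + {x : X & mQ (K x)})%type (inl (mstart M))
    (fun q h => match q with
     | inl q1 => let: (r, w, mv) := mdelta q1 h in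
        (inl (match r with
              | inl q' => inl q'
              | inr x => inr (Tagged (fun x => mQ (K x)) (mstart (K x)))
              end), w, mv)
     | inr (existT x q2) => let: (r, w, mv) := mdelta q2 h in
        (match r with
         | inl q' => inl (inr (Tagged (fun x => mQ (K x)) q'))
         | inr y => inr y
         end, w, mv)
     end).

Definition mloop X (M : mach (option X)) : mach X :=
  @Mach X (mQ M) (mstart M)
    (fun q h => let: (r, w, mv) := mdelta q h in
       (match r with
        | inl q' => inl q'
        | inr None => inl (mstart M)
        | inr (Some x) => inr x
        end, w, mv)).

Lemma runs_act X (f : sym -> X * sym * move) l v x w mv :
  f (head Blank v) = (x, w, mv) -> runs (act f) (l, v) 1 x (tmove w mv (l, v)).
Proof. by move=> e; apply: mrun_exit; rewrite /= e. Qed.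

Lemma runs_bind (X : finType) Y (M : mach X) (K : X -> mach Y) tp t x tp1 t2 y tp2 :
  runs M tp t x tp1 -> runs (K x) tp1 t2 y tp2 ->
  runs (mbind M K) tp (t + t2) y tp2.
Proof.
rewrite /runs /=; elim=> {tp t x tp1} [q tp w mv x e|q q' tp w mv t x tp' e _ IH] r2.
  rewrite add1n; apply: mrun_step; first by rewrite /= e.
  elim: r2 => {tp2 t2 y} [q2 tp2 w2 mv2 y e2|q2 q3 tp2 w2 mv2 t2 y tp3 e2 _ IH].
    by apply: mrun_exit; rewrite /= e2.
  by apply: mrun_step IH; rewrite /= e2.
by rewrite addSn; apply: mrun_step (IH r2); rewrite /= e.
Qed.

Lemma runs_loop_exit X (M : mach (option X)) tp t x tp1 :
  runs M tp t (Some x) tp1 -> runs (mloop M) tp t x tp1.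
Proof.
rewrite /runs /=; move: (mstart M) => q r.
have [o eo] : exists o, o = Some x by exists (Some x).
rewrite -eo in r; elim: r eo => {q tp t o tp1} [q tp w mv o e|q q' tp w mv t o tp' e _ IH] eo.
  by apply: mrun_exit; rewrite /= e eo.
by apply: mrun_step (IH eo); rewrite /= e.
Qed.

Lemma runs_loop_next X (M : mach (option X)) tp t tp1 t2 x tp2 :
  runs M tp t None tp1 -> runs (mloop M) tp1 t2 x tp2 ->
  runs (mloop M) tp (t + t2) x tp2.
Proof.
(* Occurrences 1 and 3 describe where the current pass stands and become arbitrary for the
   induction; occurrence 2 is the restart and stays the start state. *)
rewrite /runs /=; move: {1 3}(mstart M) => q r.
have [o eo] : exists o, o = @None X by exists None.
rewrite -eo in r; elim: r eo => {q tp t o tp1} [q tp w mv o e|q q' tp w mv t o tp' e _ IH] eo r2.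
  by rewrite add1n; apply: mrun_step r2; rewrite /= e eo.
by rewrite addSn; apply: mrun_step (IH eo r2); rewrite /= e.
Qed.

Definition TM_of (X : finType) (M : mach X) : TM :=
  @Build_TM (mQ M + X)%type (inl (mstart M))
    (fun q => if q is inr _ then true else false)
    (fun q h => match q with
      | inl q1 => let: (r, w, mv) := mdelta q1 h in (r, w, mv)
      | inr x => (inr x, h, Stay) end).

Definition tm_config (X : finType) (M : mach X) (q : mQ M + X) (tp : tape) :
  config (TM_of M) := (q, tp.1, head Blank tp.2, behead tp.2).

Lemma tm_step_mach (X : finType) (M : mach X) (q : mQ M) tp r w mv :
  mdelta q (head Blank tp.2) = (r, w, mv) ->
  tm_step (tm_config (inl q) tp) = tm_config r (tmove w mv tp).
Proof.
case: tp => l v /= e; rewrite /tm_config /= e.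
by case: mv e => _ //=; [case: l | case: v => [|? []]].
Qed.

Lemma iter_halted (X : finType) (M : mach X) x tp t :
  iter t (@tm_step (TM_of M)) (tm_config (inr x) tp) = tm_config (inr x) tp.
Proof. by elim: t => //= t ->. Qed.

Lemma iter_mrun (X : finType) (M : mach X) q tp t x tp' :
  mrun q tp t x tp' ->
  iter t (@tm_step (TM_of M)) (tm_config (inl q) tp) = tm_config (inr x) tp'.
Proof.
elim=> {q tp t x tp'} [q tp w mv x e|q q' tp w mv t x tp' e _ IH].
  exact: (tm_step_mach e).
by rewrite iterSr (tm_step_mach e).
Qed.

Lemma computes_within (X : finType) (M : mach X) w t x tp t' o :
  runs M ([::], map sym_of_bool w) t x tp -> (t <= t')%N ->
  read_word (head Blank tp.2 :: behead tp.2) = o ->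
  tm_computes_within (TM_of M) t' w o.
Proof.
move=> r le_t ro; rewrite /tm_computes_within /tm_run.
have -> : tm_init (TM_of M) w =
          tm_config (inl (mstart M)) ([::], map sym_of_bool w).
  by case: w {r}.
by rewrite -(subnK le_t) iterD (iter_mrun r) iter_halted.
Qed.

(** * Bit stacks on the tape *)

Notation blanks := (nseq^~ Blank).

Definition ret X (x : X) : mach X := act (fun h => (x, h, Stay)).

(** Home is the first cell of the word, found by scanning left to a blank, as words contain none.
    The scan begins with a blind move left because the head may stand on the blank just past the
    word. *)
Definition gohome : mach unit :=
  mbind (act (fun h => (tt, h, MoveL))) (fun _ : unit =>
    mloop (act (fun h => if h is Blank then (Some tt, Blank, MoveR)
                         else (None, h, MoveL)))).

(** The scan consumes one blank on the left and writes it back, so at least one is explicit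
    afterwards even if [a] is 0; likewise the cell first scanned becomes explicit in [v']. *)
Lemma runs_gohome u v a :
  exists v', [/\ runs gohome (rev (map s_ u) ++ blanks a, v) (size u).+2 tt
      (blanks a.-1.+1, v') & v' = map s_ u ++ head Blank v :: behead v].
Proof.
eexists; split; last by [].
rewrite -(add1n (_.+1)); apply: runs_bind; first by apply: runs_act.
rewrite /tmove /=; move: (head Blank v) (behead v) => {v}.
elim/last_ind: u => [|u b IH] h v /=.
  case: a => [|a] /=; apply: runs_loop_exit;
  by apply: (@runs_act _ _ _ (Blank :: h :: v) _ Blank MoveR).
rewrite size_rcons map_rcons rev_rcons /= -(add1n (_.+1)).
apply: runs_loop_next; first by apply: runs_act; case: (b).
by rewrite /tmove /= -cats1 -catA; apply: IH.
Qed.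

Definition insert (c : bool) : mach unit :=
  @Mach unit bool c (fun c h => match h with
    | Blank => (inr tt, s_ c, Stay)
    | S0 => (inl false, s_ c, MoveR)
    | S1 => (inl true, s_ c, MoveR) end).

Lemma runs_insert c l u b :
  runs (insert c) (l, map s_ u ++ blanks b) (size u).+1 tt
    (rev (map s_ (belast c u)) ++ l, s_ (last c u) :: blanks b.-1).
Proof.
have H : forall c0, mrun (M := insert c0) c (l, map s_ u ++ blanks b) (size u).+1 tt
    (rev (map s_ (belast c u)) ++ l, s_ (last c u) :: blanks b.-1); last exact: H.
move=> c0; elim: u c l => [|x u IH] c l /=.
  have e : blanks b.-1 = behead (blanks b) by case: (b).
  rewrite e; apply: (mrun_exit (M := insert c0) (tp := (l, blanks b)) (mv := Stay)).
  by case: (b).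
rewrite rev_cons cat_rcons.
apply: (mrun_step (M := insert c0) (q' := x) (w := s_ c) (mv := MoveR)).
  by case: x.
exact: IH.
Qed.

Definition shift_left : mach unit :=
  @Mach unit (option bool) None (fun c h =>
    let w := if c is Some b then s_ b else Blank in
    match h with
    | Blank => (inr tt, w, Stay)
    | S0 => (inl (Some false), w, MoveL)
    | S1 => (inl (Some true), w, MoveL) end).

(** The doomed cell is blanked first: coming back from the far end, [shift_left] recognises the hole
    as the place to stop. *)
Definition delete : mach unit :=
  mbind (act (fun h => (tt, Blank, MoveR))) (fun _ : unit =>
  mbind (mloop (act (fun h => if h is Blank then (Some tt, Blank, MoveL)
                         else (None, h, MoveR)))) (fun _ : unit => shift_left)).

Lemma mrun_shift_left c u l v :
  mrun (M := shift_left) c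
    (behead (map s_ u ++ Blank :: l), head Blank (map s_ u ++ Blank :: l) :: v)
    (size u).+1 tt
    (l, rev (map s_ u) ++ (if c is Some b then s_ b else Blank) :: v).
Proof.
elim: u c v => [|x u IH] c v /=.
  exact: (mrun_exit (M := shift_left) (tp := (l, Blank :: v)) (mv := Stay)).
rewrite rev_cons cat_rcons.
apply: (mrun_step (M := shift_left) (q' := Some x)
  (w := if c is Some b then s_ b else Blank) (mv := MoveL)).
  by case: x.
exact: IH.
Qed.

Lemma runs_delete l x u b :
  exists b', runs delete (l, x :: map s_ u ++ blanks b) (size u).*2.+3 tt
    (l, map s_ u ++ blanks b').
Proof.
exists b.-1.+2; rewrite -addnn -2!addSn -!addnS.
have -> : (size u).+2 + (size u).+1 = 1 + ((size u).+1 + (size u).+1) by [].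
apply: runs_bind; first exact: runs_act.
rewrite /tmove /=; apply: (runs_bind (x := tt)
  (tp1 := (behead (map s_ (rev u) ++ Blank :: l),
           head Blank (map s_ (rev u) ++ Blank :: l) :: blanks b.-1.+1))).
  rewrite -[map s_ (rev u) ++ _]/(map s_ (rev u) ++ (Blank :: l)).
  move: (Blank :: l) => {}l; elim: u l => [|y u IH] l /=.
    have -> : Blank :: blanks b.-1 = Blank :: behead (blanks b) by case: (b).
    by apply: runs_loop_exit; apply: (@runs_act _ _ _ (blanks b) _ Blank MoveL); case: (b).
  rewrite -(add1n (_.+1)); apply: runs_loop_next.
    by apply: runs_act; case: (y).
  by rewrite /tmove /= rev_cons map_rcons cat_rcons; apply: IH.
have := mrun_shift_left None (rev u) l (blanks b.-1.+1).
by rewrite size_rev map_rev revK.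
Qed.

Definition skip1 : mach unit :=
  mloop (mbind (act (fun h => (if h is S1 then true else false, h, MoveR)))
    (fun b : bool => act (fun h => (if b then None else Some tt, h, MoveR)))).

Lemma runs_skip1 l f v :
  runs skip1 (l, map s_ (field f) ++ v) (size (field f)) tt
    (rev (map s_ (field f)) ++ l, v).
Proof.
elim: f l => [|b f IH] l.
  rewrite /field /=; apply: runs_loop_exit; rewrite -[2]/(1 + 1).
  apply: (runs_bind (x := false)); first exact: (@runs_act _ _ _ (S0 :: _)).
  exact: (@runs_act _ _ _ (S0 :: v) _ S0 MoveR).
rewrite /field /= -[flatten _ ++ _]/(field f) -add2n.
apply: runs_loop_next.
  rewrite -[2]/(1 + 1); apply: (runs_bind (x := true)); first exact: runs_act.
  exact: (@runs_act _ _ _ (s_ b :: _) _ (s_ b) MoveR).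
by rewrite /tmove /= !rev_cons !cat_rcons; apply: IH.
Qed.

Fixpoint skipthen X j (M : mach X) : mach X :=
  if j is j'.+1 then mbind skip1 (fun _ : unit => skipthen j' M) else M.

Definition fields (fs : seq (seq bool)) := flatten (map field fs).

Lemma runs_skipthen X (M : mach X) fs l v t x tp :
  runs M (rev (map s_ (fields fs)) ++ l, v) t x tp ->
  runs (skipthen (size fs) M) (l, map s_ (fields fs) ++ v)
    (size (fields fs) + t) x tp.
Proof.
elim: fs l => [|f fs IH] l //=.
rewrite /fields /= map_cat rev_cat -catA => r.
rewrite size_cat -addnA -catA; apply: runs_bind; first exact: runs_skip1.
exact: IH.
Qed.

Lemma normalise_blanks u b :
  exists b', let v := map s_ u ++ blanks b in
    head Blank v :: behead v = map s_ u ++ blanks b'.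
Proof.
by case: u => [|x u]; [case: b => [|b]; [exists 1|exists b.+1]|exists b].
Qed.

Lemma runs_gohome_word u1 u2 a b :
  exists a' b', runs gohome (rev (map s_ u1) ++ blanks a, map s_ u2 ++ blanks b)
    (size u1).+2 tt (blanks a', map s_ (u1 ++ u2) ++ blanks b').
Proof.
have [b' e] := normalise_blanks u2 b.
have [v' [r ev]] := runs_gohome u1 (map s_ u2 ++ blanks b) a.
by exists a.-1.+1, b'; rewrite map_cat -catA -e -ev.
Qed.

Definition insert_at j c : mach unit :=
  mbind (skipthen j (insert c)) (fun _ : unit => gohome).

Lemma runs_insert_at fs c u a b :
  exists T a' b', T <= (size (fields fs ++ u)).*2 + 3 /\
    runs (insert_at (size fs) c)
      (blanks a, map s_ (fields fs ++ u) ++ blanks b) T tt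
      (blanks a', map s_ (fields fs ++ c :: u) ++ blanks b').
Proof.
have := runs_skipthen (runs_insert c (rev (map s_ (fields fs)) ++ blanks a) u b).
rewrite catA -map_cat catA -rev_cat -map_cat => r.
have [a' [b' r2]] := runs_gohome_word (fields fs ++ belast c u) [:: last c u] a b.-1.
have {r r2} := runs_bind (K := fun _ => gohome) r r2.
rewrite -catA cats1 -lastI => r.
eexists _, a', b'; split; last exact: r.
by rewrite !size_cat size_belast; lia.
Qed.

(** Both insertions are at the front of field [j], so the data bit goes in before its marker
    [true]. *)
Definition push j c : mach unit :=
  mbind (insert_at j c) (fun _ : unit => insert_at j true).

Definition pop_field j : mach (option bool) := skipthen j
  (mbind (act (fun h => if h is S1 then (true, h, MoveR) else (false, h, Stay)))
    (fun b : bool => if b then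
      mbind (act (fun h => (if h is S1 then true else false, h, MoveL)))
        (fun c : bool => mbind delete (fun _ : unit => mbind delete
          (fun _ : unit => mbind gohome (fun _ : unit => ret (Some c)))))
     else mbind gohome (fun _ : unit => ret None))).

Definition pop_raw j : mach (option bool) := skipthen j
  (mbind (act (fun h =>
     (match h with Blank => None | S0 => Some false | S1 => Some true end, h, Stay)))
   (fun ob : option bool => match ob with
     | None => mbind gohome (fun _ : unit => ret None)
     | Some c => mbind delete (fun _ : unit =>
                   mbind gohome (fun _ : unit => ret (Some c)))
     end)).

(* The tape holds the fields of the stacks [st.1] followed by the unframed word
   [st.2]; the input is initially, and the output finally, that word. *)
Definition stacks := (seq (seq bool) * seq bool)%type.
Definition word (st : stacks) := fields st.1 ++ st.2.
Definition holds (st : stacks) (tp : tape) :=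
  exists a b, tp = (blanks a, map s_ (word st) ++ blanks b).

(** Time is counted in stack operations, each linear in the tape length. Since a unit adds at most
    two cells, one [Z] bounds the tape during the entire run and serves both halves of a
    composition, which makes units additive. The factor 20 generously covers the passes of one
    primitive. *)
Definition srun X (M : mach X) (s : stacks) (t : nat) (x : X) (s' : stacks) :=
  size (word s') <= size (word s) + t.*2 /\
  forall Z tp, size (word s) + t.*2 <= Z -> holds s tp ->
  exists T tp', [/\ runs M tp T x tp', T <= t * (20 * Z.+1) & holds s' tp'].

Lemma fields_cat fs f gs : fields (fs ++ f :: gs) = fields fs ++ field f ++ fields gs.
Proof. by rewrite /fields map_cat flatten_cat. Qed.

Lemma size_field f : size (field f) = (size f).*2 + 2.
Proof.
by rewrite /field size_cat; congr (_ + _); elim: f => //= b f ->; lia.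
Qed.

Lemma word_cat pre f post raw :
  word (pre ++ f :: post, raw) = fields pre ++ field f ++ (fields post ++ raw).
Proof.
by rewrite /word fields_cat -(catA (fields pre)) -(catA (field f)).
Qed.

Lemma size_word pre f post raw :
  size (word (pre ++ f :: post, raw)) =
  size (fields pre) + (size f).*2 + size (fields post) + size raw + 2.
Proof.
rewrite /word fields_cat size_cat (size_cat (fields pre)) (size_cat (field f)).
rewrite size_field /=; lia.
Qed.

Lemma srun_insert_raw stks raw c :
  srun (insert_at (size stks) c) (stks, raw) 1 tt (stks, c :: raw).
Proof.
split=> [|Z tp leZ [a [b ->]]]; first by rewrite /word !size_cat /=; lia.
have [T [a' [b' [leT r]]]] := runs_insert_at stks c raw a b.
exists T; eexists; split; [exact: r| |by exists a', b'].
by rewrite /word /= in leZ; lia.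
Qed.

Lemma srun_push j c stks raw : j < size stks ->
  srun (push j c) (stks, raw) 1 tt
    (set_nth [::] stks j (c :: nth [::] stks j), raw).
Proof.
move=> lt_j; rewrite set_nthE lt_j.
rewrite -{1}(cat_take_drop j stks) (drop_nth [::] lt_j).
have sj : size (take j stks) = j by rewrite size_take lt_j.
move: (take j _) (drop _ _) (nth _ _ _) sj => pre post f <-.
split=> [|Z tp leZ [a [b ->]]].
  by rewrite !size_word /=; lia.
rewrite size_word in leZ; rewrite word_cat.
have [T [a' [b' [leT r]]]] :=
  runs_insert_at pre c (field f ++ fields post ++ raw) a b.
have [T2 [a2 [b2 [leT2 r2]]]] :=
  runs_insert_at pre true (c :: field f ++ fields post ++ raw) a' b'.
exists (T + T2); eexists; split; [exact: runs_bind r r2| |exists a2, b2; congr (_, map _ _ ++ _)].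
  move: leT leT2; rewrite /= !(size_cat (fields pre)) /= (size_cat (field f)).
  rewrite size_cat size_field; lia.
by rewrite word_cat.
Qed.

Lemma runs_gohome_ret X (x : X) u1 u2 a b :
  exists tp a' b',
   [/\ runs (mbind gohome (fun _ : unit => ret x))
      (rev (map s_ u1) ++ blanks a, map s_ u2 ++ blanks b) ((size u1).+2 + 1) x tp
    & tp = (blanks a', map s_ (u1 ++ u2) ++ blanks b')].
Proof.
have [a' [b' r]] := runs_gohome_word u1 u2 a b.
have [b2 e] := normalise_blanks (u1 ++ u2) b'.
eexists _, a', b2; split.
  by apply: runs_bind r _; apply: runs_act.
by rewrite /tmove /= -e; case: (_ ++ _).
Qed.

Lemma srun_pop_nil j stks raw : j < size stks -> nth [::] stks j = [::] ->
  srun (pop_field j) (stks, raw) 1 None (stks, raw).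
Proof.
move=> lt_j nj; split=> [|Z tp leZ [a [b ->]]]; first by lia.
have := cat_take_drop j stks; rewrite (drop_nth [::] lt_j) nj.
have sj : size (take j stks) = j by rewrite size_take lt_j.
move: (take j _) (drop _ _) sj => pre post <- es; subst stks.
rewrite size_word in leZ; rewrite word_cat map_cat -catA.
have [tp2 [a' [b' [r etp]]]] := runs_gohome_ret (@None bool) (fields pre)
  (false :: false :: fields post ++ raw) a b.
eexists _, tp2; split.
- apply: (runs_skipthen (t := 1 + _)).
  apply: (runs_bind (x := false)); last exact: r.
  exact: (@runs_act _ _ _ (S0 :: _) _ S0 Stay).
- lia.
- by exists a', b'; rewrite word_cat etp.
Qed.

Lemma srun_pop_cons j stks raw c f : j < size stks -> nth [::] stks j = c :: f ->
  srun (pop_field j) (stks, raw) 1 (Some c) (set_nth [::] stks j f, raw).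
Proof.
move=> lt_j nj; rewrite set_nthE lt_j.
have := cat_take_drop j stks; rewrite (drop_nth [::] lt_j) nj.
have sj : size (take j stks) = j by rewrite size_take lt_j.
move: (take j _) (drop _ _) sj => pre post <- es; subst stks.
split=> [|Z tp leZ [a [b ->]]].
  by rewrite !size_word /=; lia.
rewrite size_word in leZ; rewrite word_cat map_cat -catA.
set w := field f ++ (fields post ++ raw).
have [b1 r1] := runs_delete (rev (map s_ (fields pre)) ++ blanks a) S1 (c :: w) b.
have [b2 r2] := runs_delete (rev (map s_ (fields pre)) ++ blanks a) (s_ c) w b1.
have [tp2 [a' [b' [r etp]]]] := runs_gohome_ret (Some c) (fields pre) w a b2.
eexists _, tp2; split.
- apply: (runs_skipthen (t := 1 + _)).
  apply: (runs_bind (x := true)); first exact: (@runs_act _ _ _ (S1 :: _) _ S1 MoveR).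
  apply: (runs_bind (x := c)).
    apply: (@runs_act _ _ _ (s_ c :: _) _ (s_ c) MoveL); by case: (c).
  apply: runs_bind r1 _; apply: runs_bind r2 _; exact: r.
- have := size_cat (field f) (fields post ++ raw); rewrite -/w size_field size_cat /=.
  rewrite /= in leZ; lia.
- by exists a', b'; rewrite word_cat etp.
Qed.

Lemma srun_pop_raw_nil stks :
  srun (pop_raw (size stks)) (stks, [::]) 1 None (stks, [::]).
Proof.
split=> [|Z tp leZ [a [b ->]]]; first by lia.
rewrite /word /= cats0 in leZ *.
have [b2 e] := normalise_blanks [::] b.
have [tp2 [a' [b' [r etp]]]] := runs_gohome_ret (@None bool) (fields stks) [::] a b2.
eexists _, tp2; split.
- apply: (runs_skipthen (t := 1 + _)).
  apply: (runs_bind (x := None)); last exact: r.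
  rewrite /= in e *; rewrite -e; case: (b) => [|b3].
    exact: (@runs_act _ _ _ [::] _ Blank Stay).
  exact: (@runs_act _ _ _ (Blank :: _) _ Blank Stay).
- lia.
- by exists a', b'; rewrite etp /word /=.
Qed.

Lemma srun_pop_raw_cons stks c raw :
  srun (pop_raw (size stks)) (stks, c :: raw) 1 (Some c) (stks, raw).
Proof.
split=> [|Z tp leZ [a [b ->]]]; first by rewrite /word !size_cat /=; lia.
rewrite /word /= map_cat -catA in leZ *.
have [b1 r1] := runs_delete (rev (map s_ (fields stks)) ++ blanks a) (s_ c) raw b.
have [tp2 [a' [b' [r etp]]]] := runs_gohome_ret (Some c) (fields stks) raw a b1.
eexists _, tp2; split.
- apply: (runs_skipthen (t := 1 + _)).
  apply: (runs_bind (x := Some c)).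
    by apply: (@runs_act _ _ _ (s_ c :: _) _ (s_ c) Stay); case: (c).
  apply: runs_bind r1 _; exact: r.
- rewrite !size_cat /= in leZ *; lia.
- by exists a', b'; rewrite etp /word /=.
Qed.

Lemma srun_bind (X : finType) Y (M : mach X) (K : X -> mach Y) s t x s1 t2 y s2 :
  srun M s t x s1 -> srun (K x) s1 t2 y s2 -> srun (mbind M K) s (t + t2) y s2.
Proof.
move=> [le1 r1] [le2 r2]; split=> [|Z tp leZ h]; first by lia.
have [||T1 [tp1 [R1 leT1 h1]]] := r1 Z tp; [lia|by []|].
have [||T2 [tp2 [R2 leT2 h2]]] := r2 Z tp1; [lia|by []|].
by exists (T1 + T2), tp2; split=> //; [apply: runs_bind R1 R2|nia].
Qed.

Lemma srun_loop_exit X (M : mach (option X)) s t x s1 :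
  srun M s t (Some x) s1 -> srun (mloop M) s t x s1.
Proof.
move=> [le1 r1]; split=> // Z tp leZ h.
have [||T1 [tp1 [R1 leT1 h1]]] := r1 Z tp; [lia|by []|].
by exists T1, tp1; split=> //; apply: runs_loop_exit.
Qed.

Lemma srun_loop_next X (M : mach (option X)) s t s1 t2 x s2 :
  srun M s t None s1 -> srun (mloop M) s1 t2 x s2 ->
  srun (mloop M) s (t + t2) x s2.
Proof.
move=> [le1 r1] [le2 r2]; split=> [|Z tp leZ h]; first by lia.
have [||T1 [tp1 [R1 leT1 h1]]] := r1 Z tp; [lia|by []|].
have [||T2 [tp2 [R2 leT2 h2]]] := r2 Z tp1; [lia|by []|].
by exists (T1 + T2), tp2; split=> //; [apply: runs_loop_next R1 R2|nia].
Qed.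

Lemma srun_ret X (x : X) s : srun (ret x) s 1 x s.
Proof.
split=> [|Z tp leZ [a [b ->]]]; first by lia.
have [b2 e] := normalise_blanks (word s) b.
eexists 1, _; split; [by apply: runs_act|lia|].
by exists a, b2; rewrite /tmove /= -e.
Qed.

(** * A machine on a heap of binary trees *)

Inductive tree := Leaf | Node of tree & tree.

Definition tcar t := if t is Node a _ then a else Leaf.
Definition tcdr t := if t is Node _ b then b else Leaf.

Inductive exp :=
| EId | ENil | ECar | ECdr
| EPair of exp & exp | EComp of exp & exp | EIf of exp & exp & exp
| EIter of exp.

Fixpoint eval N e x := match e with
  | EId => x
  | ENil => Leaf
  | ECar => tcar x
  | ECdr => tcdr x
  | EPair e1 e2 => Node (eval N e1 x) (eval N e2 x)
  | EComp e1 e2 => eval N e1 (eval N e2 x)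
  | EIf e1 e2 e3 => if eval N e1 x is Leaf then eval N e3 x else eval N e2 x
  | EIter e1 => iter N (eval N e1) x
  end.

Definition sb (M : mach unit) s c s' := exists2 t, t <= c & srun M s t tt s'.

Definition mseq (M1 M2 : mach unit) := mbind M1 (fun _ : unit => M2).
Infix ";;" := mseq (at level 61, right associativity).

Lemma sb_seq M1 M2 s c1 s1 c2 s2 c :
  sb M1 s c1 s1 -> sb M2 s1 c2 s2 -> c1 + c2 <= c -> sb (M1 ;; M2) s c s2.
Proof.
move=> [t1 le1 r1] [t2 le2 r2] le; exists (t1 + t2); first by lia.
exact: srun_bind r1 r2.
Qed.

Lemma sb_le M s c s' c' : sb M s c s' -> c <= c' -> sb M s c' s'.
Proof. by move=> [t le r] le'; exists t => //; lia. Qed.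

Definition loopE j f1 f0 : mach unit :=
  mloop (mbind (pop_field j) (fun ob : option bool => match ob with
    | None => ret (Some tt)
    | Some b => mbind (if b then f1 else f0) (fun _ : unit => ret None) end)).

Definition loopZ j f : mach unit :=
  mloop (mbind (pop_field j) (fun ob : option bool => match ob with
    | Some true => mbind f (fun _ : unit => ret None)
    | _ => ret (Some tt) end)).

(** The invariant [P] separates the bits still on the stack from those already handled; the latter
    pile up in reverse order, hence [catrev]. *)
Lemma sb_loopE j f1 f0 c (P : seq bool -> seq bool -> stacks) w d :
  (forall b w d, srun (pop_field j) (P (b :: w) d) 1 (Some b) (P w d)) ->
  (forall d, srun (pop_field j) (P [::] d) 1 None (P [::] d)) ->
  (forall b w d, sb (if b then f1 else f0) (P w d) c (P w (b :: d))) ->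
  sb (loopE j f1 f0) (P w d) (size w * (c + 2) + 2) (P [::] (catrev w d)).
Proof.
move=> Hc Hn Hf; elim: w d => [|b w IH] d.
  exists 2 => //; apply: srun_loop_exit; rewrite -[2]/(1 + 1).
  by apply: srun_bind (Hn _) _; apply: srun_ret.
have [t1 le1 r1] := Hf b w d; have [t2 le2 r2] := IH (b :: d).
exists (1 + (t1 + 1) + t2); first by rewrite /=; lia.
apply: srun_loop_next r2; apply: srun_bind (Hc _ _ _) _.
by apply: srun_bind r1 _; apply: srun_ret.
Qed.

Lemma sb_loopZ_stop j f s s' : srun (pop_field j) s 1 (Some false) s' ->
  sb (loopZ j f) s 2 s'.
Proof.
move=> r; exists 2 => //; apply: srun_loop_exit; rewrite -[2]/(1 + 1).
by apply: srun_bind r _; apply: srun_ret.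
Qed.

Lemma sb_loopZ_next j f s s1 c s2 c' s3 c'' :
  srun (pop_field j) s 1 (Some true) s1 -> sb f s1 c s2 ->
  sb (loopZ j f) s2 c' s3 -> c + c' + 2 <= c'' -> sb (loopZ j f) s c'' s3.
Proof.
move=> r [t1 le1 r1] [t2 le2 r2] le; exists (1 + (t1 + 1) + t2); first by lia.
apply: srun_loop_next r2; apply: srun_bind r _.
by apply: srun_bind r1 _; apply: srun_ret.
Qed.

Lemma sb_loopZ j f c (Q : nat -> nat -> stacks) s n d :
  (forall n d, srun (pop_field j) (Q n.+1 d) 1 (Some true) (Q n d)) ->
  (forall n d, sb f (Q n d) c (Q n d.+1)) ->
  srun (pop_field j) (Q 0 (n + d)) 1 (Some false) s ->
  sb (loopZ j f) (Q n d) (n * (c + 2) + 2) s.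
Proof.
move=> Hc Hf; elim: n d => [|n IH] d; first exact: sb_loopZ_stop.
rewrite addSnnS => /IH r.
by apply: sb_loopZ_next (Hc _ _) (Hf _ _) r _; lia.
Qed.

(* Unary number [a] on top of the stack [r]. *)
Definition nm a r : seq bool := ncons a true (false :: r).
Arguments nm : simpl never.

(** [H] holds the heap, [T] is scratch space, [S] carries the current address, and [D] saves
    addresses and loop counters. [C] and [N] consist of bare marks without terminator: the number of
    cells and the input length. *)
Definition iH := 0. Definition iT := 1. Definition iS := 2. Definition iD := 3.
Definition iC := 4. Definition iN := 5.

Definition nop : mach unit := ret tt.
Lemma sb_nop s : sb nop s 1 s.
Proof. by exists 1 => //; apply: srun_ret. Qed.

Lemma sb_push j b stks raw : j < size stks ->
  sb (push j b) (stks, raw) 1 (set_nth [::] stks j (b :: nth [::] stks j), raw).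
Proof. by move=> lt; exists 1 => //; apply: srun_push. Qed.

Lemma catrev_nseq n (r : seq bool) : catrev (nseq n true) r = ncons n true r.
Proof.
elim: n r => //= n IH r; rewrite IH; elim: n {IH} => //= n ->; done.
Qed.

Lemma nconsSr n (r : seq bool) : ncons n true (true :: r) = ncons n.+1 true r.
Proof. by elim: n => //= n ->. Qed.

Definition move_num i j := push j false ;; loopZ i (push j true).

Definition move_all i j := loopE i (push j true) (push j false).

Definition copySD := push iD false ;; loopZ iS (push iD true ;; push iT true) ;;
  push iS false ;; move_all iT iS.

Definition copyND := push iD false ;;
  loopE iN (push iD true ;; push iT true) (push iD true ;; push iT true) ;; move_all iT iN.

Definition swapSD := move_num iS iT ;; move_num iD iS ;; move_num iT iD.

Definition dropS := loopZ iS nop.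

(** New cells go to the far end of the heap so that old addresses stay valid: the heap is turned
    over onto [T], extended there, and turned back. As address 0 is reserved, the new address is the
    new cell count, copied from [C]. *)
Definition cons_cell :=
  move_all iH iT ;; loopZ iD (push iT true) ;; push iT false ;;
  loopZ iS (push iT true) ;; push iT false ;; move_all iT iH ;;
  push iC true ;; push iS false ;; move_all iC iT ;;
  loopE iT (push iC true ;; push iS true) (push iC true ;; push iS true).

Definition shift_num := loopZ iH (push iT true) ;; push iT false.

(** Popping one mark both tests for [Leaf] and turns the address [i.+1] into the index [i]. Numbers
    passed on the way are parked on [T], from where the heap is restored. *)
Definition lookup (b : bool) := mbind (pop_field iS) (fun ob : option bool =>
  if ob is Some true then
    loopZ iS (shift_num ;; shift_num) ;; (if b then shift_num else nop) ;;
    push iS false ;; loopZ iH (push iT true ;; push iS true) ;; push iT false ;;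
    move_all iT iH
  else push iS false).

Fixpoint compile e : mach unit := match e with
  | EId => nop
  | ENil => dropS ;; push iS false
  | ECar => lookup false
  | ECdr => lookup true
  | EPair e1 e2 => copySD ;; compile e1 ;; swapSD ;; compile e2 ;; cons_cell
  | EComp e1 e2 => compile e2 ;; compile e1
  | EIf e1 e2 e3 => copySD ;; compile e1 ;;
      mbind (pop_field iS) (fun ob : option bool =>
        if ob is Some true then dropS ;; move_num iD iS ;; compile e2
        else move_num iD iS ;; compile e3)
  | EIter e1 => copyND ;; loopZ iD (compile e1)
  end.

Section Macros.
Variables (H T S D C NN raw : seq bool).
Local Notation st H T S D C NN := ([:: H; T; S; D; C; NN], raw).

Lemma sb_moveDS a :
  sb (move_num iD iS) (st H T S (nm a D) C NN) (3 * a + 3) (st H T (nm a S) D C NN).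
Proof.
apply: sb_seq; first exact: sb_push.
  apply: (sb_loopZ (c := 1) (d := 0)
    (Q := fun n d => st H T (nm d S) (nm n D) C NN)) => /=.
  - by move=> n d; apply: srun_pop_cons.
  - by move=> n d; apply: sb_push.
  - by rewrite addn0; apply: srun_pop_cons.
lia.
Qed.

Lemma sb_moveST a :
  sb (move_num iS iT) (st H T (nm a S) D C NN) (3 * a + 3) (st H (nm a T) S D C NN).
Proof.
apply: sb_seq; first exact: sb_push.
  apply: (sb_loopZ (c := 1) (d := 0)
    (Q := fun n d => st H (nm d T) (nm n S) D C NN)) => /=.
  - by move=> n d; apply: srun_pop_cons.
  - by move=> n d; apply: sb_push.
  - by rewrite addn0; apply: srun_pop_cons.
lia.
Qed.

Lemma sb_moveTD a :
  sb (move_num iT iD) (st H (nm a T) S D C NN) (3 * a + 3) (st H T S (nm a D) C NN).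
Proof.
apply: sb_seq; first exact: sb_push.
  apply: (sb_loopZ (c := 1) (d := 0)
    (Q := fun n d => st H (nm n T) S (nm d D) C NN)) => /=.
  - by move=> n d; apply: srun_pop_cons.
  - by move=> n d; apply: sb_push.
  - by rewrite addn0; apply: srun_pop_cons.
lia.
Qed.

Lemma sb_move_allHT :
  sb (move_all iH iT) (st H T S D C NN) (3 * size H + 2)
     (st [::] (catrev H T) S D C NN).
Proof.
apply: sb_le.
  apply: (sb_loopE (c := 1) (P := fun w d => st w d S D C NN)) => /=.
  - by move=> b w d; apply: srun_pop_cons.
  - by move=> d; apply: srun_pop_nil.
  - by move=> [] w d; apply: sb_push.
lia.
Qed.

Lemma sb_move_allTH :
  sb (move_all iT iH) (st H T S D C NN) (3 * size T + 2)
     (st (catrev T H) [::] S D C NN).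
Proof.
apply: sb_le.
  apply: (sb_loopE (c := 1) (P := fun w d => st d w S D C NN)) => /=.
  - by move=> b w d; apply: srun_pop_cons.
  - by move=> d; apply: srun_pop_nil.
  - by move=> [] w d; apply: sb_push.
lia.
Qed.

Lemma sb_move_allTS :
  sb (move_all iT iS) (st H T S D C NN) (3 * size T + 2)
     (st H [::] (catrev T S) D C NN).
Proof.
apply: sb_le.
  apply: (sb_loopE (c := 1) (P := fun w d => st H w d D C NN)) => /=.
  - by move=> b w d; apply: srun_pop_cons.
  - by move=> d; apply: srun_pop_nil.
  - by move=> [] w d; apply: sb_push.
lia.
Qed.

Lemma sb_move_allTN :
  sb (move_all iT iN) (st H T S D C NN) (3 * size T + 2)
     (st H [::] S D C (catrev T NN)).
Proof.
apply: sb_le.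
  apply: (sb_loopE (c := 1) (P := fun w d => st H w S D C d)) => /=.
  - by move=> b w d; apply: srun_pop_cons.
  - by move=> d; apply: srun_pop_nil.
  - by move=> [] w d; apply: sb_push.
lia.
Qed.

Lemma sb_move_allCT :
  sb (move_all iC iT) (st H T S D C NN) (3 * size C + 2)
     (st H (catrev C T) S D [::] NN).
Proof.
apply: sb_le.
  apply: (sb_loopE (c := 1) (P := fun w d => st H d S D w NN)) => /=.
  - by move=> b w d; apply: srun_pop_cons.
  - by move=> d; apply: srun_pop_nil.
  - by move=> [] w d; apply: sb_push.
lia.
Qed.

End Macros.

Section Macros2.
Variables (H S D C NN raw : seq bool).
Local Notation st H T S D C NN := ([:: H; T; S; D; C; NN], raw).

Lemma sb_copySD a :
  sb copySD (st H [::] (nm a S) D C NN) (7 * a + 10)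
     (st H [::] (nm a S) (nm a D) C NN).
Proof.
rewrite [in X in sb _ _ _ X]/nm -[ncons a true (false :: S)]catrev_nseq.
apply: sb_seq; first exact: sb_push.
  apply: sb_seq.
    apply: (sb_loopZ (c := 2) (d := 0)
      (Q := fun n d => st H (nseq d true) (nm n S) (nm d D) C NN)) => /=.
    - by move=> n d; apply: srun_pop_cons.
    - by move=> n d; apply: sb_seq; [apply: sb_push|apply: sb_push|].
    - by rewrite addn0; apply: srun_pop_cons.
  apply: sb_seq; first exact: sb_push.
    rewrite /=; exact: sb_move_allTS.
  exact: leqnn.
  exact: leqnn.
rewrite size_nseq; lia.
Qed.

Lemma sb_copyND n :
  sb copyND (st H [::] S D C (nseq n true)) (7 * n + 10)
     (st H [::] S (nm n D) C (nseq n true)).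
Proof.
rewrite -[in X in sb _ _ _ X](cats0 (nseq n true)) cat_nseq -catrev_nseq.
apply: sb_seq; first exact: sb_push.
  apply: sb_seq.
    apply: (sb_loopE (c := 2)
      (P := fun w d => st H (nseq (size d) true) S (nm (size d) D) C w) _ [::]) => /=.
    - by move=> b w d; apply: srun_pop_cons.
    - by move=> d; apply: srun_pop_nil.
    - by move=> [] w d /=; (apply: sb_seq; [apply: sb_push|apply: sb_push|]).
  rewrite catrevE cats0 size_rev size_nseq; exact: sb_move_allTN.
  exact: leqnn.
rewrite /= !size_nseq; lia.
Qed.

Lemma sb_swapSD a b :
  sb swapSD (st H [::] (nm a S) (nm b D) C NN) (6 * a + 3 * b + 9)
    (st H [::] (nm b S) (nm a D) C NN).
Proof.
apply: sb_seq; first exact: sb_moveST.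
  by apply: sb_seq; [exact: sb_moveDS|exact: sb_moveTD|exact: leqnn].
lia.
Qed.

Lemma sb_dropS a T : sb dropS (st H T (nm a S) D C NN) (3 * a + 2) (st H T S D C NN).
Proof.
apply: sb_le.
  apply: (sb_loopZ (c := 1) (d := 0)
    (Q := fun n _ => st H T (nm n S) D C NN)) => /=.
  - by move=> n d; apply: srun_pop_cons.
  - by move=> n d; apply: sb_nop.
  - by apply: srun_pop_cons.
lia.
Qed.

Lemma catrev_ncons a (r d : seq bool) :
  catrev (ncons a true r) d = catrev r (ncons a true d).
Proof. by elim: a d => //= a IH d; rewrite IH nconsSr. Qed.

Lemma sb_cons_cell a b n :
  sb cons_cell (st H [::] (nm b S) (nm a D) (nseq n true) NN)
    (6 * size H + 10 * (a + b + n) + 60)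
    (st (H ++ nm a (nm b [::])) [::] (nm n.+1 S) D (nseq n.+1 true) NN).
Proof.
have eH : H ++ nm a (nm b [::]) =
    catrev (false :: ncons b true (false :: ncons a true (rev H))) [::].
  rewrite /= catrev_ncons /= catrev_ncons catrevE revK /nm.
  by congr (_ ++ _).
apply: sb_seq; first exact: sb_move_allHT.
  apply: sb_seq.
    apply: (sb_loopZ (c := 1) (d := 0)
      (Q := fun n' d => st [::] (ncons d true (catrev H [::])) (nm b S) (nm n' D) (nseq n true) NN)) => /=.
    - by move=> n' d; apply: srun_pop_cons.
    - by move=> n' d; apply: sb_push.
    - by rewrite addn0; apply: srun_pop_cons.
  apply: sb_seq; first exact: sb_push.
    rewrite /=; apply: sb_seq.
      apply: (sb_loopZ (c := 1) (d := 0)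
        (Q := fun n' d => st [::] (ncons d true (false :: ncons a true (catrev H [::]))) (nm n' S) D (nseq n true) NN)) => /=.
      - by move=> n' d; apply: srun_pop_cons.
      - by move=> n' d; apply: sb_push.
      - by rewrite addn0; apply: srun_pop_cons.
    apply: sb_seq; first exact: sb_push.
      rewrite /=; apply: sb_seq; first exact: sb_move_allTH.
        apply: sb_seq; first exact: sb_push.
          apply: sb_seq; first exact: sb_push.
            rewrite /=; apply: sb_seq; first exact: sb_move_allCT.
              rewrite (catrev_nseq n.+1) eH.
              (* Both counts are restated as the length of the processed word, the form in which the
                 invariant of the copying loop delivers them. *)
              have -> : nm n.+1 S = nm (size (catrev (nseq n.+1 true) [::])) S.
                by rewrite (catrev_nseq n.+1) size_ncons addn0.
              have -> : [:: catrev (false :: ncons b true (false :: ncons a true (rev H))) [::]; [::];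
   nm (size (catrev (nseq n.+1 true) [::])) S; D; nseq n.+1 true; NN] =
 [:: catrev (false :: ncons b true (false :: ncons a true (rev H))) [::]; [::];
   nm (size (catrev (nseq n.+1 true) [::])) S; D; nseq (size (catrev (nseq n.+1 true) [::])) true; NN].
                by rewrite (catrev_nseq n.+1) size_ncons addn0.
              apply: (sb_loopE (c := 2)
                (P := fun w d => st _ w (nm (size d) S) D (nseq (size d) true) NN) _ [::]) => /=.
              - by move=> b' w d; apply: srun_pop_cons.
              - by move=> d; apply: srun_pop_nil.
              - by move=> [] w d /=; (apply: sb_seq; [apply: sb_push|apply: sb_push|]).
            exact: leqnn.
          exact: leqnn.
        exact: leqnn.
      exact: leqnn.
    exact: leqnn.
  exact: leqnn.
exact: leqnn.
exact: leqnn.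
rewrite /= !size_ncons /= !size_ncons !catrevE !cats0 !size_rev; lia.
Qed.

End Macros2.

(** * Shared heaps and the trees they represent *)

Definition heap := seq (nat * nat).

Fixpoint ench (h : heap) r : seq bool :=
  if h is (a, b) :: h' then nm a (nm b (ench h' r)) else r.

Lemma ench_cat h1 h2 r : ench (h1 ++ h2) r = ench h1 (ench h2 r).
Proof. by elim: h1 => //= [[a b] h1 ->]. Qed.

Lemma nm_cat a r r' : nm a r ++ r' = nm a (r ++ r').
Proof. by rewrite /nm; elim: a => //= a ->. Qed.

Lemma ench_catr h r r' : ench h r ++ r' = ench h (r ++ r').
Proof. by elim: h => //= [[a b] h] IH; rewrite !nm_cat IH. Qed.

Lemma size_nm a r : size (nm a r) = a + (size r).+1.
Proof. by rewrite /nm size_ncons. Qed.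

Lemma catrev_nm a r d : catrev (nm a r) d = catrev r (false :: ncons a true d).
Proof. by rewrite /nm catrev_ncons. Qed.

(* Address [0] is [Leaf]; address [i.+1] is the [i]-th allocated cell. *)
Inductive rep (h : heap) : nat -> tree -> Prop :=
| rep0 : rep h 0 Leaf
| repS i a b x y : i < size h -> nth (0, 0) h i = (a, b) ->
    rep h a x -> rep h b y -> rep h i.+1 (Node x y).

(** Caps the unary length of addresses and thereby the length of the heap word. That lookups return
    the right subtree comes from [rep] instead. *)
Definition wf_heap (h : heap) :=
  all (fun p => (p.1 <= size h) && (p.2 <= size h)) h.

Lemma rep_le h a x : rep h a x -> a <= size h.
Proof. by case. Qed.

Lemma rep_cat h h' a x : rep h a x -> rep (h ++ h') a x.
Proof.
elim=> [|i b c y z lt e _ IHy _ IHz]; first exact: rep0.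
apply: repS IHy IHz; first by rewrite size_cat; lia.
by rewrite nth_cat lt.
Qed.

Lemma wf_heap_size h r : wf_heap h ->
  size (ench h r) <= size h * (2 * size h + 2) + size r.
Proof.
(* The address bound must stay fixed while the list shrinks in the induction. *)
suff gen c : all (fun p => (p.1 <= c) && (p.2 <= c)) h ->
    size (ench h r) <= size h * (2 * c + 2) + size r by apply: gen.
elim: h => //= [[a b] h] IH /andP[/andP[/= le1 le2] /IH le].
by rewrite !size_nm /=; nia.
Qed.

Section Lookup.
Variables (D C NN raw : seq bool).
Local Notation st H T S := ([:: H; T; S; D; C; NN], raw).

Lemma sb_shift_num a H T S :
  sb shift_num (st (nm a H) T S) (3 * a + 3) (st H (false :: ncons a true T) S).
Proof.
apply: sb_seq.
- apply: (sb_loopZ (c := 1) (d := 0)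
    (Q := fun n' d => st (nm n' H) (ncons d true T) S)) => /=.
  + by move=> n' d; apply: srun_pop_cons.
  + by move=> n' d; apply: sb_push.
  + by rewrite addn0; apply: srun_pop_cons.
- exact: sb_push.
- lia.
Qed.

Lemma sb_shift_cells n h h' c T S : size h = n ->
  all (fun p => (p.1 <= c) && (p.2 <= c)) h ->
  sb (loopZ iS (shift_num ;; shift_num)) (st (ench h h') T (nm n S))
    (n * (6 * c + 8) + 2) (st h' (catrev (ench h [::]) T) S).
Proof.
elim: n h T => [|n IH] [|[a b] h] T //=.
  by move=> _ _; apply: sb_loopZ_stop; apply: srun_pop_cons.
move=> [sh] /andP[/andP[/= le1 le2] al].
apply: (sb_loopZ_next (c := 6 * c + 6) (s1 := st (nm a (nm b (ench h h'))) T (nm n S))).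
- by apply: srun_pop_cons.
- by apply: sb_seq; [exact: sb_shift_num|exact: sb_shift_num|lia].
- by rewrite !catrev_nm; apply: (IH h).
lia.
Qed.

Lemma sb_lookup (b : bool) h a S : wf_heap h -> a <= size h ->
  sb (lookup b) (st (ench h [::]) [::] (nm a S)) (30 * (size h).+1 ^ 2)
    (st (ench h [::]) [::]
      (nm (if a is i.+1 then let p := nth (0, 0) h i in if b then p.2 else p.1 else 0) S)).
Proof.
move=> gh; case: a => [_|i lti].
  exists 2; first by nia.
  rewrite -[2]/(1 + 1); apply: (srun_bind (x := Some false)).
    by apply: srun_pop_cons.
  exact: srun_push.
set p := nth _ _ _; rewrite /=.
set h1 := take i h; set h2 := drop i.+1 h.
have eh : h = h1 ++ p :: h2 by rewrite -drop_nth // cat_take_drop.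
have leS := wf_heap_size [::] gh; rewrite /= addn0 in leS.
have := gh; rewrite /wf_heap {3}eh all_cat /= => /and3P[al1 /andP[le1 le2] al2].
have sh1 : size h1 = i by rewrite size_take lti.
have [t2 let2 r2] : sb (loopZ iS (shift_num ;; shift_num) ;;
    (if b then shift_num else nop) ;;
    push iS false ;; loopZ iH (push iT true ;; push iS true) ;; push iT false ;;
    move_all iT iH) (st (ench h [::]) [::] (nm i S))
    (i * (6 * size h + 8) + 2 + (3 * size h + 3 + (1 + (size h * 4 + 2 + (1 + (3 * size (ench h [::]) + 2))))))
  (st (ench h [::]) [::] (nm (if b then p.2 else p.1) S)).
  set m := (if b then p.2 else p.1).
  (* Both components are treated alike: when copying starts, the wanted number heads the remaining
     heap, and turning [T] back over restores the original. *)
  have [T [H [eHT eH]]] : exists T H,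
    sb (if b then shift_num else nop) (st (ench (p :: h2) [::]) (catrev (ench h1 [::]) [::]) S)
      (3 * size h + 3) (st (nm m H) T S) /\
    catrev (false :: ncons m true T) H = ench h [::].
    rewrite eh ench_cat [X in ench h1 X]/= {}/m -eh; case: b.
      case: (p) le1 le2 => [x y] /= le1 le2; eexists _, _; split.
        by apply: sb_le; [exact: sb_shift_num|lia].
      by rewrite /= catrev_ncons /= catrev_ncons !catrevE cats0 revK ench_catr.
    case: (p) le1 le2 => [x y] /= le1 le2; eexists _, _; split.
      by apply: sb_le; [exact: sb_nop|lia].
    by rewrite /= catrev_ncons !catrevE cats0 revK ench_catr.
  have lem : m <= size h by rewrite /m; case: (b).
  apply: sb_seq; [|apply: sb_seq; [exact: eHT| |exact: leqnn]|exact: leqnn].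
    rewrite {1}eh ench_cat; exact: sb_shift_cells.
  apply: sb_seq; [exact: sb_push| |exact: leqnn].
  apply: sb_seq; [| |exact: leqnn].
    apply: (sb_le (c := m * (2 + 2) + 2)); last by lia.
    apply: (sb_loopZ (c := 2) (d := 0)
      (Q := fun n' d => st (nm n' H) (ncons d true T) (nm d S))) => /=.
    - by move=> n' d; apply: srun_pop_cons.
    - by move=> n' d; apply: sb_seq; [apply: sb_push|apply: sb_push|].
    - by rewrite addn0; apply: srun_pop_cons.
  apply: sb_seq; [exact: sb_push| |exact: leqnn].
  rewrite /= -eH; apply: sb_le; first exact: sb_move_allTH.
  by rewrite catrevE size_cat size_rev; lia.
exists (1 + t2); first by nia.
apply: (srun_bind (x := Some true)) r2.
by apply: srun_pop_cons.
Qed.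
End Lookup.

(** * Operation counts and correctness of compilation *)

Fixpoint cost N e := match e with
  | EId | ENil | ECar | ECdr => 1
  | EPair e1 e2 => cost N e1 + cost N e2 + 3
  | EComp e1 e2 => cost N e1 + cost N e2
  | EIf e1 e2 e3 => cost N e1 + cost N e2 + cost N e3 + 4
  | EIter e1 => N * (cost N e1).+1 + 2
  end.

(** A well-formed heap of c cells takes at most c (2c + 2) bits, so a pass over it is quadratic in
    c; the factor 100 absorbs the passes of the costliest operation. *)
Definition opcost c := 100 * c.+1 ^ 2.

Definition hst (h : heap) S D N raw : stacks :=
  ([:: ench h [::]; [::]; S; D; nseq (size h) true; nseq N true], raw).

Lemma opcost_le c c' : c <= c' -> opcost c <= opcost c'.
Proof. by move=> le; rewrite /opcost leq_mul2l leq_exp2r //= ltnS le. Qed.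

Lemma leq_opcost k c : k <= 100 * c.+1 -> k <= opcost c.
Proof. by rewrite /opcost; nia. Qed.

Lemma sb_alloc h a b x y S D N raw : wf_heap h -> rep h a x -> rep h b y ->
  exists p, [/\ wf_heap (h ++ [:: p]), rep (h ++ [:: p]) (size h).+1 (Node x y) &
    sb cons_cell (hst h (nm b S) (nm a D) N raw) (opcost (size h))
      (hst (h ++ [:: p]) (nm (size h).+1 S) D N raw)].
Proof.
move=> gh ra rb; exists (a, b); split.
- rewrite /wf_heap all_cat size_cat /= !andbT; apply/and3P; split.
  + by apply: sub_all gh => q; lia.
  + by have := rep_le ra; lia.
  + by have := rep_le rb; lia.
- apply: (repS (a := a) (b := b)); [by rewrite size_cat /=; lia| |exact: rep_cat|exact: rep_cat].
  by rewrite nth_cat ltnn subnn.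
have leS := wf_heap_size [::] gh; rewrite addn0 in leS.
have := sb_cons_cell (ench h [::]) S D (nseq N true) raw a b (size h).
rewrite ench_catr /= -[nm a (nm b [::])]/(ench [:: (a, b)] [::]) -ench_cat.
rewrite /hst size_cat addn1 => r; apply: sb_le r _.
by have := rep_le ra; have := rep_le rb; rewrite /opcost; nia.
Qed.

(** [cost] bounds new cells and operations at once, without reference to the argument. Every
    operation is charged at the final heap size, which is sound because heaps only grow. With
    [N <= size h], copying the loop counter costs no more than one [opcost]. *)
Lemma compile_correct e N raw : forall h a x S D,
  wf_heap h -> N <= size h -> rep h a x ->
  exists h' a', [/\ wf_heap (h ++ h'), rep (h ++ h') a' (eval N e x),
    size h' <= cost N e &
    sb (compile e) (hst h (nm a S) D N raw) (cost N e * opcost (size (h ++ h')))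
      (hst (h ++ h') (nm a' S) D N raw)].
Proof.
elim: e => [||||e1 IH1 e2 IH2|e1 IH1 e2 IH2|e1 IH1 e2 IH2 e3 IH3|e IH] h a x S D gh leN ra;
  have lea := rep_le ra; rewrite [eval _ _ _]/= [cost _ _]/=.
- exists [::], a; rewrite cats0; split=> //.
  by rewrite mul1n; apply: sb_le (sb_nop _) _; apply: leq_opcost; lia.
- exists [::], 0; rewrite cats0; split=> //; first exact: rep0.
  rewrite mul1n; apply: sb_seq; [exact: sb_dropS|exact: sb_push|].
  by apply: leq_opcost; lia.
- exists [::]; rewrite cats0; eexists; split=> //; last first.
    by rewrite mul1n; apply: sb_le; [exact: sb_lookup|rewrite /opcost; nia].
  by case: ra => [|i b c y z lt e ry rz] /=; [exact: rep0|rewrite e].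
- exists [::]; rewrite cats0; eexists; split=> //; last first.
    by rewrite mul1n; apply: sb_le; [exact: sb_lookup|rewrite /opcost; nia].
  by case: ra => [|i b c y z lt e ry rz] /=; [exact: rep0|rewrite e].
- have [h1 [a1 [g1 r1 s1 sb1]]] := IH1 h a x S (nm a D) gh leN ra.
  have [||h2 [a2 [g2 r2 s2 sb2]]] := IH2 (h ++ h1) a x S (nm a1 D) g1.
  + by rewrite size_cat; lia.
  + exact: rep_cat.
  have [p [g3 r3 sb3]] := sb_alloc S D N raw g2 (rep_cat h2 r1) r2.
  exists (h1 ++ h2 ++ [:: p]), (size ((h ++ h1) ++ h2)).+1.
  rewrite !catA; split=> //; first by rewrite !size_cat /=; lia.
  have lea1 := rep_le r1; have lea2 := rep_le r2.
  set c := size _.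
  have c1 : size (h ++ h1) <= c by rewrite /c !size_cat; lia.
  have c2 : size ((h ++ h1) ++ h2) <= c by rewrite /c !size_cat; lia.
  have c0 : size h <= c by rewrite /c !size_cat; lia.
  have o1 := opcost_le c1; have o2 := opcost_le c2.
  apply: (sb_le (c := opcost c + (cost N e1 * opcost c + (opcost c + (cost N e2 * opcost c + opcost c))))); last by nia.
  apply: sb_seq; [|apply: sb_seq; [|apply: sb_seq; [|apply: sb_seq; [| |exact: leqnn]|exact: leqnn]|exact: leqnn]|exact: leqnn].
  + by apply: sb_le; [exact: sb_copySD|apply: leq_opcost; lia].
  + by apply: sb_le sb1 _; nia.
  + by apply: sb_le; [exact: sb_swapSD|apply: leq_opcost; lia].
  + by apply: sb_le sb2 _; nia.
  + by apply: sb_le sb3 _; nia.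
- have [h2 [a2 [g2 r2 s2 sb2]]] := IH2 h a x S D gh leN ra.
  have [||h1 [a1 [g1 r1 s1 sb1]]] := IH1 (h ++ h2) a2 (eval N e2 x) S D g2.
  + by rewrite size_cat; lia.
  + exact: r2.
  exists (h2 ++ h1), a1; rewrite catA; split=> //; first by rewrite size_cat; lia.
  set c := size _.
  have c1 : size (h ++ h2) <= c by rewrite /c !size_cat; lia.
  have o1 := opcost_le c1.
  apply: sb_seq; [exact: sb2|exact: sb1|].
  by rewrite mulnDl addnC leq_add2l leq_mul2l o1 orbT.
- have [h1 [a1 [g1 r1 s1 sb1]]] := IH1 h a x S (nm a D) gh leN ra.
  have lea1 := rep_le r1.
  have leN1 : N <= size (h ++ h1) by rewrite size_cat; lia.
  case: a1 (eval N e1 x) / r1 lea1 sb1 => [|i b c y z lt e ry rz] lea1 sb1.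
    have [h3 [a3 [g3 r3 s3 sb3]]] := IH3 (h ++ h1) a x S D g1 leN1 (rep_cat h1 ra).
    exists (h1 ++ h3), a3; rewrite catA; split=> //; first by rewrite size_cat; lia.
    set k := size _.
    have c1 : size (h ++ h1) <= k by rewrite /k !size_cat; lia.
    have c0 : size h <= k by rewrite /k !size_cat; lia.
    have o1 := opcost_le c1; have o0 := opcost_le c0.
    have [t le r] : sb (move_num iD iS ;; compile e3) (hst (h ++ h1) S (nm a D) N raw)
        (opcost k + cost N e3 * opcost k) (hst ((h ++ h1) ++ h3) (nm a3 S) D N raw).
      apply: sb_seq; [exact: sb_moveDS|exact: sb3|].
      by apply: leq_add; [apply: leq_opcost; lia|].
    have step : sb (copySD ;; compile e1 ;; mbind (pop_field iS) (fun ob : option bool =>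
        if ob is Some true then dropS ;; move_num iD iS ;; compile e2
        else move_num iD iS ;; compile e3))
      (hst h (nm a S) D N raw) (opcost k + (cost N e1 * opcost k + (1 + (opcost k + cost N e3 * opcost k))))
      (hst ((h ++ h1) ++ h3) (nm a3 S) D N raw).
      apply: sb_seq; [|apply: sb_seq; [| |exact: leqnn]|exact: leqnn].
      + by apply: sb_le; [exact: sb_copySD|apply: leq_opcost; lia].
      + by apply: sb_le sb1 _; nia.
      exists (1 + t); first by lia.
      apply: (srun_bind (x := Some false)) r; exact: srun_pop_cons.
    apply: sb_le step _.
    have : 1 <= opcost k by rewrite /opcost; nia.
    by nia.
  have [h2 [a2 [g2 r2 s2 sb2]]] := IH2 (h ++ h1) a x S D g1 leN1 (rep_cat h1 ra).
  exists (h1 ++ h2), a2; rewrite catA; split=> //; first by rewrite size_cat; lia.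
  set k := size _.
  have c1 : size (h ++ h1) <= k by rewrite /k !size_cat; lia.
  have c0 : size h <= k by rewrite /k !size_cat; lia.
  have o1 := opcost_le c1; have o0 := opcost_le c0.
  have [t le r] : sb (dropS ;; move_num iD iS ;; compile e2) (hst (h ++ h1) (nm i S) (nm a D) N raw)
      (opcost k + (opcost k + cost N e2 * opcost k)) (hst ((h ++ h1) ++ h2) (nm a2 S) D N raw).
    apply: sb_seq; [exact: sb_dropS| |]; last first.
      apply: leq_add; last exact: leqnn.
      by apply: leq_opcost; lia.
    apply: sb_seq; [exact: sb_moveDS|exact: sb2|].
    by apply: leq_add; [apply: leq_opcost; lia|].
  have step : sb (copySD ;; compile e1 ;; mbind (pop_field iS) (fun ob : option bool =>
      if ob is Some true then dropS ;; move_num iD iS ;; compile e2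
      else move_num iD iS ;; compile e3))
    (hst h (nm a S) D N raw) (opcost k + (cost N e1 * opcost k + (1 + (opcost k + (opcost k + cost N e2 * opcost k)))))
    (hst ((h ++ h1) ++ h2) (nm a2 S) D N raw).
    apply: sb_seq; [|apply: sb_seq; [| |exact: leqnn]|exact: leqnn].
    + by apply: sb_le; [exact: sb_copySD|apply: leq_opcost; lia].
    + by apply: sb_le sb1 _; nia.
    exists (1 + t); first by lia.
    apply: (srun_bind (x := Some true)) r; exact: srun_pop_cons.
  apply: sb_le step _.
  have : 1 <= opcost k by rewrite /opcost; nia.
  by nia.
(* The counter [n] on [D] is separated from the fuel [N], which loops nested in the body still read
   in full. *)
have loop n : forall h a x, wf_heap h -> N <= size h -> rep h a x ->
  exists h' a', [/\ wf_heap (h ++ h'), rep (h ++ h') a' (iter n (eval N e) x),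
    size h' <= n * cost N e &
    sb (loopZ iD (compile e)) (hst h (nm a S) (nm n D) N raw)
      (n * (cost N e * opcost (size (h ++ h')) + 2) + 2)
      (hst (h ++ h') (nm a' S) D N raw)].
  elim: n => [|n IHn] {gh leN ra lea}h {}a {}x gh leN ra.
    exists [::], a; rewrite cats0; split=> //.
    by apply: sb_loopZ_stop; apply: srun_pop_cons.
  have [h1 [a1 [g1 r1 s1 sb1]]] := IH h a x S (nm n D) gh leN ra.
  have leN1 : N <= size (h ++ h1) by rewrite size_cat; lia.
  have [h2 [a2 [g2 r2 s2 sb2]]] := IHn _ _ _ g1 leN1 r1.
  exists (h1 ++ h2), a2; rewrite catA iterSr; split=> //.
    by rewrite size_cat mulSn; lia.
  set k := size _ in sb2 *.
  have c1 : size (h ++ h1) <= k by rewrite /k !size_cat; lia.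
  have o1 := opcost_le c1.
  apply: sb_loopZ_next sb1 sb2 _; first exact: srun_pop_cons.
  by nia.
have [h' [a' [g' r' s' sb']]] := loop N h a x gh leN ra.
exists h', a'; split=> //; first by lia.
set k := size _ in sb' *.
have c0 : size h <= k by rewrite /k !size_cat; lia.
apply: sb_seq; [exact: sb_copyND|exact: sb'|].
have : 7 * N + 10 <= opcost k by apply: leq_opcost; lia.
have : 2 <= opcost k by rewrite /opcost; nia.
by nia.
Qed.

(** The base is at least 2, so constants and sums are absorbed by raising the exponent. *)
Definition polyb (f : nat -> nat) := exists d, forall N, f N <= N.+2 ^ d.

Lemma polyb_le f g : polyb g -> (forall N, f N <= g N) -> polyb f.
Proof. by move=> [d le] lefg; exists d => N; apply: leq_trans (le N). Qed.

Lemma polyb_const c : polyb (fun=> c).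
Proof.
exists c => N; apply: (@leq_trans (2 ^ c)); first exact: ltnW (ltn_expl _ _).
by case: c => // c; rewrite leq_exp2r.
Qed.

Lemma polyb_id : polyb id.
Proof. by exists 1 => N; rewrite expn1; lia. Qed.

Lemma polyb_mul f g : polyb f -> polyb g -> polyb (fun N => f N * g N).
Proof.
move=> [d1 le1] [d2 le2]; exists (d1 + d2) => N; rewrite expnD.
exact: leq_mul.
Qed.

Lemma polyb_add f g : polyb f -> polyb g -> polyb (fun N => f N + g N).
Proof.
move=> [d1 le1] [d2 le2]; exists (d1 + d2).+1 => N; rewrite expnS expnD.
have := le1 N; have := le2 N.
have : 0 < N.+2 ^ d1 by rewrite expn_gt0.
have : 0 < N.+2 ^ d2 by rewrite expn_gt0.
by nia.
Qed.

Lemma polyb_cost e : polyb (cost^~ e).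
Proof.
elim: e => /= [||||e1 IH1 e2 IH2|e1 IH1 e2 IH2|e1 IH1 e2 IH2 e3 IH3|e IH];
  try exact: polyb_const;
  do ?[apply: polyb_add => //; try exact: polyb_const].
apply: polyb_mul; first exact: polyb_id.
by apply: (polyb_le (polyb_add IH (polyb_const 1))) => N; lia.
Qed.

(** * Input and output of the heap machine *)

Definition tbool (b : bool) := if b then Node Leaf Leaf else Leaf.
Definition tbits (w : seq bool) := foldr (fun b t => Node (tbool b) t) Leaf w.

Fixpoint zeros n := if n is n'.+1 then insert_at 0 false ;; zeros n' else nop.

(** The heap starts with the cell (0, 0), so address [b] represents [tbool b] and one new cell per
    bit suffices. Reading from the front builds the list in reverse. *)
Definition reader := mloop (mbind (pop_raw 6) (fun ob : option bool => match ob with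
  | None => ret (Some tt)
  | Some b => mbind (push iD false ;; (if b then push iD true else nop) ;;
                     cons_cell ;; push iN true) (fun _ : unit => ret None) end)).

(** Each bit is inserted in front of the raw word, so the output too comes out reversed. *)
Definition writer := mloop (mbind (pop_field iS) (fun ob : option bool =>
  if ob is Some true then
    mbind (push iS true ;; copySD ;; lookup false ;;
      mbind (pop_field iS) (fun ob : option bool => if ob is Some true
        then dropS ;; insert_at 6 true ;; move_num iD iS ;; lookup true
        else insert_at 6 false ;; move_num iD iS ;; lookup true))
      (fun _ : unit => ret None)
  else ret (Some tt))).

(** Twelve zeros in front of the input read as six empty fields [00]. The closing [skipthen] places
    the head on the raw word, where the output is read. *)
Definition exp_machine e : mach unit := mbind (zeros 12 ;;
  push iH false ;; push iH false ;; push iC true ;; push iS false ;;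
  reader ;; compile e ;; writer) (fun _ : unit => skipthen 6 (ret tt)).

Lemma srun_word X (M : mach X) s t x s' u u' : srun M s t x s' ->
  word s = word u -> word s' = word u' -> srun M u t x u'.
Proof.
move=> [le r] e e'; split=> [|Z tp leZ h]; first by rewrite -e -e'.
have [||T [tp' [R leT h']]] := r Z tp; [by rewrite e|by rewrite /holds e|].
by exists T, tp'; split=> //; rewrite /holds -e'.
Qed.

Lemma sb_zeros n raw : sb (zeros n) ([::], raw) n.+1 ([::], nseq n false ++ raw).
Proof.
elim: n raw => [|n IH] raw /=; first exact: sb_nop.
have <- : nseq n false ++ false :: raw = false :: nseq n false ++ raw.
  by rewrite -cat_rcons; elim: n {IH} => //= n ->.
apply: (@sb_seq _ _ _ 1 ([::], false :: raw) n.+1); [|exact: IH|exact: leqnn].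
by exists 1 => //; apply: (srun_insert_raw [::]).
Qed.

Lemma sb_reader w : forall h a x j, wf_heap h -> nth (0, 0) h 0 = (0, 0) -> 0 < size h ->
  rep h a x ->
  exists h' a', [/\ wf_heap (h ++ h'),
    rep (h ++ h') a' (foldl (fun x b => Node (tbool b) x) x w), size h' = size w &
    sb reader (hst h (nm a [::]) [::] j w)
      (size w * (opcost (size (h ++ h')) + 10) + 2)
      (hst (h ++ h') (nm a' [::]) [::] (j + size w) [::])].
Proof.
elim: w => [|b w IH] h a x j gh h0 sh ra.
  exists [::], a; rewrite cats0 addn0; split=> //; exists 2 => //.
  apply: srun_loop_exit; rewrite -[2]/(1 + 1).
  by apply: srun_bind (srun_pop_raw_nil _) _; apply: srun_ret.
have rb : rep h b (tbool b).
  by case: b; [apply: repS (rep0 h) (rep0 h)|exact: rep0].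
have [p [g1 r1 [t1 le1 sb1]]] := sb_alloc [::] [::] j w gh rb ra.
have [||h' [a' [g' r' s' [t2 le2 sb2]]]] := IH _ _ _ j.+1 g1 _ _ r1.
- by rewrite nth_cat sh.
- by rewrite size_cat; lia.
exists (p :: h'), a'; rewrite -cat_rcons -cats1 /= s'; split=> //.
set k := size ((h ++ [:: p]) ++ h') in le2 *.
have c0 : size h <= k by rewrite /k !size_cat; lia.
have o0 := opcost_le c0.
have [t le r] : sb (push iD false ;; (if b then push iD true else nop) ;;
    cons_cell ;; push iN true) (hst h (nm a [::]) [::] j w) (opcost k + 3)
   (hst (h ++ [:: p]) (nm (size h).+1 [::]) [::] j.+1 w).
  apply: (sb_le (c := 1 + (1 + (opcost k + 1)))); last by lia.
  apply: sb_seq; [exact: sb_push| |exact: leqnn].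
  apply: (@sb_seq _ _ _ _ (hst h (nm a [::]) (nm b [::]) j w)); [| |exact: leqnn].
    by case: (b); [exact: sb_push|exact: sb_nop].
  apply: sb_seq; [exists t1; [|exact: sb1]|exact: sb_push|exact: leqnn].
  by lia.
exists (1 + (t + 1) + t2); first by nia.
rewrite (addnS j) -(addSn j); apply: srun_loop_next sb2.
apply: srun_bind (srun_pop_raw_cons _ _ _) _.
by apply: srun_bind r _; apply: srun_ret.
Qed.

Lemma sb_writer N h o : wf_heap h -> forall a raw, rep h a (tbits o) ->
  exists a', sb writer (hst h (nm a [::]) [::] N raw)
    (size o * (5 * opcost (size h) + 10) + 2)
    (hst h a' [::] N (catrev o raw)).
Proof.
move=> gh; set k := size h; elim: o => [|b o IH] a raw /= ra.
  exists [::]; exists 2 => //.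
  apply: srun_loop_exit; rewrite -[2]/(1 + 1).
  apply: (srun_bind (x := Some false)); last exact: srun_ret.
  by inversion ra; apply: srun_pop_cons.
have lea := rep_le ra.
have [i [x [y [ea rx ry lti ei]]]] : exists i x y, [/\ a = i.+1, rep h x (tbool b),
    rep h y (tbits o), i < size h & nth (0, 0) h i = (x, y)].
  by inversion ra; exists i, a0, b0.
have elk1 : (if a is j.+1 then let p := nth (0, 0) h j in p.2 else 0) = y.
  by rewrite ea /= ei.
have elk0 : (if a is j.+1 then let p := nth (0, 0) h j in p.1 else 0) = x.
  by rewrite ea /= ei.
have [a' [t2 le2 sb2]] := IH y (b :: raw) ry.
have lex := rep_le rx.
have k1 : 7 * k + 10 <= opcost k by apply: leq_opcost; lia.
have k2 : 30 * k.+1 ^ 2 <= opcost k by rewrite /opcost; nia.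
have [t3 le3 r3] : sb (insert_at 6 b ;; move_num iD iS ;; lookup true)
    (hst h [::] (nm a [::]) N raw) (1 + (opcost k + opcost k))
    (hst h (nm y [::]) [::] N (b :: raw)).
  apply: sb_seq; [| |exact: leqnn].
    by exists 1 => //; apply: srun_insert_raw [:: _; _; _; _; _; _] _ _.
  apply: sb_seq; [apply: (sb_le (sb_moveDS _ _ _ _ _ _ _ _))| |exact: leqnn].
    by apply: leq_trans k1; lia.
  have := sb_lookup [::] (nseq (size h) true) (nseq N true) (b :: raw) true [::] gh lea.
  by rewrite elk1 => r; apply: sb_le r _.
have [t le r] : sb (push iS true ;; copySD ;; lookup false ;;
      mbind (pop_field iS) (fun ob : option bool => if ob is Some true
        then dropS ;; insert_at 6 true ;; move_num iD iS ;; lookup true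
        else insert_at 6 false ;; move_num iD iS ;; lookup true))
    (hst h (nm i [::]) [::] N raw)
    (1 + (opcost k + (opcost k + (1 + (opcost k + (1 + (opcost k + opcost k)))))))
    (hst h (nm y [::]) [::] N (b :: raw)).
  apply: sb_seq; [exact: sb_push| |exact: leqnn].
  apply: sb_seq; [apply: (sb_le (c := 7 * a + 10)) |  |exact: leqnn].
  - rewrite ea; exact: sb_copySD.
  - by apply: leq_trans k1; lia.
  apply: sb_seq; [| |exact: leqnn].
    have := sb_lookup (nm a [::]) (nseq (size h) true) (nseq N true) raw false [::] gh lea.
    by rewrite elk0 => r; apply: sb_le r _.
  rewrite /=; case: x rx {ei lex elk0} => [|x] rx.
    have eb : b = false by case: (b) rx => // rx; inversion rx.
    exists (1 + t3); first by lia.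
    apply: (srun_bind (x := Some false)); first exact: srun_pop_cons.
    by rewrite eb in r3 *.
  have eb : b = true by case: (b) rx => // rx; inversion rx.
  have lex := rep_le rx.
  have [t4 le4 r4] := sb_dropS (ench h [::]) [::] (nm a [::]) (nseq (size h) true) (nseq N true) raw x [::].
  have le4' : t4 <= opcost k by apply: leq_trans k1; lia.
  exists (1 + (t4 + t3)); first by lia.
  apply: (srun_bind (x := Some true)); first exact: srun_pop_cons.
  by rewrite eb in r3 *; apply: srun_bind r4 _.
exists a'; exists (1 + (t + 1) + t2); first by nia.
apply: srun_loop_next sb2; apply: (srun_bind (x := Some true)).
  by rewrite ea; apply: srun_pop_cons.
by apply: srun_bind r _; apply: srun_ret.
Qed.

Lemma foldl_tbits w x :
  foldl (fun x b => Node (tbool b) x) x w =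
  foldr (fun b t => Node (tbool b) t) x (rev w).
Proof.
by elim: w x => //= b w IH x; rewrite IH rev_cons -cats1 foldr_cat.
Qed.

(** The input list takes N cells and the initial cell (0, 0) one more; evaluation adds at most
    [cost N e]. *)
Definition heap_bound e N := N + 1 + cost N e.
Definition stack_time e N :=
  N * (opcost (heap_bound e N) + 10) + cost N e * opcost (heap_bound e N) +
  N.+2 * N.+2 * (5 * opcost (heap_bound e N) + 10) + 30.

Lemma sb_exp_machine e w o :
  eval (size w) e (tbits (rev w)) = tbits (rev o) ->
  size o <= (size w).+2 * (size w).+2 ->
  exists stks, size stks = 6 /\
  sb (zeros 12 ;; push iH false ;; push iH false ;; push iC true ;; push iS false ;;
      reader ;; compile e ;; writer) ([::], w) (stack_time e (size w)) (stks, o).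
Proof.
move=> ev so; set N := size w.
have g0 : wf_heap [:: (0, 0)] by [].
have [h1 [a1 [g1 r1 s1 sb1]]] := sb_reader w 0 g0 erefl isT (rep0 _).
have leN : N <= size ([:: (0, 0)] ++ h1) by rewrite /= s1.
rewrite foldl_tbits -/(tbits _) in r1.
have [h2 [a2 [g2 r2 s2 sb2]]] := compile_correct e [::] [::] [::] g1 leN r1.
rewrite ev in r2.
have [a3 sb3] := sb_writer N g2 [::] r2.
rewrite catrevE revK cats0 in sb3.
set st := hst _ a3 _ _ _ in sb3; exists st.1; split=> //.
set k := heap_bound e N.
have k2 : size (([:: (0, 0)] ++ h1) ++ h2) <= k.
  by rewrite !size_cat /= s1 /k /heap_bound; lia.
have k1 : size ([:: (0, 0)] ++ h1) <= k by rewrite size_cat in k2; lia.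
have o1 := opcost_le k1; have o2 := opcost_le k2.
rewrite size_rev in sb3.
apply: (sb_le (c := 13 + (1 + (1 + (1 + (1 + ((N * (opcost k + 10) + 2) +
    (cost N e * opcost k + (N.+2 * N.+2 * (5 * opcost k + 10) + 2))))))))); last first.
  by rewrite /stack_time -/k; lia.
apply: sb_seq; [| |exact: leqnn].
  have [t le r] := sb_zeros 12 w.
  exists t; [exact: le|apply: (srun_word (u' := ([:: [::]; [::]; [::]; [::]; [::]; [::]], w)) r _ _)] => //.
apply: sb_seq; [exact: sb_push| |exact: leqnn].
apply: sb_seq; [exact: sb_push| |exact: leqnn].
apply: sb_seq; [exact: sb_push| |exact: leqnn].
apply: sb_seq; [exact: sb_push| |exact: leqnn].
apply: sb_seq; [|apply: sb_seq; [| |exact: leqnn]|exact: leqnn].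
- by apply: sb_le sb1 _; rewrite leq_add2r leq_mul2l leq_add2r o1 orbT.
- by apply: sb_le sb2 _; rewrite leq_mul2l o2 orbT.
- apply: sb_le sb3 _; rewrite leq_add2r; apply: leq_mul => //; lia.
Qed.

Definition tm_time e N :=
  stack_time e N * (20 * (N + (stack_time e N).*2).+1) +
  (N + (stack_time e N).*2 + 1).

Lemma polyb_tm_time e : polyb (tm_time e).
Proof.
have pN : polyb (fun N => N) by exact: polyb_id.
have pc := polyb_cost e; have c := polyb_const.
have ph : polyb (heap_bound e).
  by rewrite /heap_bound; do 2!apply: polyb_add => //.
have po : polyb (fun N => opcost (heap_bound e N)).
  rewrite /opcost; apply: polyb_mul; first exact: c.
  have p1 : polyb (fun N => heap_bound e N + 1) by exact: polyb_add.
  by apply: (polyb_le (polyb_mul p1 p1)) => N; rewrite addn1.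
have p2 : polyb (fun N => N.+2).
  by apply: (polyb_le (polyb_add pN (c 2))) => N; lia.
have pt : polyb (stack_time e).
  rewrite /stack_time; apply: polyb_add => //; apply: polyb_add.
    apply: polyb_add; last exact: polyb_mul.
    by apply: polyb_mul => //; apply: polyb_add.
  apply: polyb_mul; first exact: polyb_mul.
  by apply: polyb_add => //; apply: polyb_mul.
have pZ : polyb (fun N => N + (stack_time e N).*2).
  apply: (polyb_le (polyb_add pN (polyb_mul (c 2) pt))) => N; lia.
rewrite /tm_time; apply: polyb_add; last exact: polyb_add.
apply: polyb_mul => //.
by apply: (polyb_le (polyb_mul (c 20) (polyb_add pZ (c 1)))) => N; lia.
Qed.

Lemma read_word_blanks o b : read_word (map s_ o ++ blanks b) = o.
Proof. by elim: o => [|[] o IH] /=; rewrite ?IH //; case: b. Qed.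

(** Reader and writer each reverse, whence the two [rev]. The bound on the output pays for the loop
    of [writer]. *)
Theorem exp_computable e : exists (M : TM) (d : nat), forall w o,
  eval (size w) e (tbits (rev w)) = tbits (rev o) ->
  size o <= (size w).+2 * (size w).+2 ->
  tm_computes_within M ((size w).+2 ^ d) w o.
Proof.
have [d led] := polyb_tm_time e; exists (TM_of (exp_machine e)), d => w o ev so.
have [stks [s6 [t let_ [le r]]]] := sb_exp_machine ev so.
set N := size w in let_ *.
have [||T [tp [R leT [a [b etp]]]]] := r (N + (stack_time e N).*2) ([::], map s_ w).
- by rewrite /word /=; rewrite -/N; lia.
- by exists 0, 0; rewrite /word /= cats0.
rewrite {}etp /word map_cat /= -catA in R.
have [b2 eb] := normalise_blanks o b.
have R2 : runs (skipthen 6 (ret tt))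
  (blanks a, map s_ (fields stks) ++ map s_ o ++ blanks b)
  (size (fields stks) + 1) tt
  (rev (map s_ (fields stks)) ++ blanks a, map s_ o ++ blanks b2).
  by rewrite -s6; apply: runs_skipthen; rewrite -eb; exact: (@runs_act _ _ _ (_ ++ _) tt (head Blank (_ ++ _)) Stay).
apply: computes_within (runs_bind R R2) _ _.
  apply: leq_trans (led N); rewrite /tm_time; apply: leq_add.
    by apply: leq_trans leT _; apply: leq_mul.
  rewrite /word /= size_cat in le; rewrite leq_add2r -/N in le *; lia.
rewrite /= -[RHS](read_word_blanks o b2).
by case: (o) => [|? ?] //=; case: b2 {eb R2}.
Qed.

(** * Functions computed by tree expressions *)

Class Enc A := enc : A -> tree.
#[global] Instance enc_bool : Enc bool := tbool.
#[global] Instance enc_prod A B `{Enc A} `{Enc B} : Enc (A * B) :=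
  fun p => Node (enc p.1) (enc p.2).
#[global] Instance enc_seq A `{Enc A} : Enc (seq A) :=
  foldr (fun x t => Node (enc x) t) Leaf.
(** Unary, so that predecessor and zero test are single operations. Only prices are stored this way;
    the numbers of the instance are bit lists. *)
#[global] Instance enc_natural : Enc nat :=
  fun n => iter n (Node Leaf) Leaf.

(* The first argument of [f] is the fuel available to its loops, the square of
   the input length. *)
Definition comp A B `{Enc A} `{Enc B} (f : nat -> A -> B) :=
  exists e, forall N x, eval N e (enc x) = enc (f (N * N) x).

Section Comp.
Context {A B C D E : Type} `{Enc A} `{Enc B} `{Enc C} `{Enc D} `{Enc E}.

Lemma comp_id : comp (fun _ (x : A) => x).
Proof. by exists EId. Qed.

Lemma comp_comp (g : nat -> B -> C) (f : nat -> A -> B) :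
  comp g -> comp f -> comp (fun F x => g F (f F x)).
Proof. by move=> [e1 h1] [e2 h2]; exists (EComp e1 e2) => N x /=; rewrite h2 h1. Qed.

Lemma comp_pair (f : nat -> A -> B) (g : nat -> A -> C) :
  comp f -> comp g -> comp (fun F x => (f F x, g F x)).
Proof. by move=> [e1 h1] [e2 h2]; exists (EPair e1 e2) => N x /=; rewrite h2 h1. Qed.

Lemma comp_fst (f : nat -> A -> B * C) : comp f -> comp (fun F x => (f F x).1).
Proof. by move=> [e h]; exists (EComp ECar e) => N x /=; rewrite h. Qed.

Lemma comp_snd (f : nat -> A -> B * C) : comp f -> comp (fun F x => (f F x).2).
Proof. by move=> [e h]; exists (EComp ECdr e) => N x /=; rewrite h. Qed.

Lemma comp_nil : comp (fun _ (_ : A) => [::] : seq B).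
Proof. by exists ENil. Qed.

Lemma comp_cons (f : nat -> A -> B) (g : nat -> A -> seq B) :
  comp f -> comp g -> comp (fun F x => f F x :: g F x).
Proof. by move=> [e1 h1] [e2 h2]; exists (EPair e1 e2) => N x /=; rewrite h2 h1. Qed.

Lemma comp_false : comp (fun _ (_ : A) => false).
Proof. by exists ENil. Qed.

Lemma comp_true : comp (fun _ (_ : A) => true).
Proof. by exists (EPair ENil ENil). Qed.

Lemma comp_if (b : nat -> A -> bool) (f g : nat -> A -> B) :
  comp b -> comp f -> comp g -> comp (fun F x => if b F x then f F x else g F x).
Proof.
move=> [e1 h1] [e2 h2] [e3 h3]; exists (EIf e1 e2 e3) => N x /=.
by rewrite h1 h2 h3; case: (b _ x).
Qed.

Lemma comp_behead (f : nat -> A -> seq B) : comp f -> comp (fun F x => behead (f F x)).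
Proof. by move=> [e h]; exists (EComp ECdr e) => N x /=; rewrite h; case: (f _ x). Qed.

Lemma comp_head_bool (f : nat -> A -> seq bool) :
  comp f -> comp (fun F x => head false (f F x)).
Proof. by move=> [e h]; exists (EComp ECar e) => N x /=; rewrite h; case: (f _ x). Qed.

Lemma comp_head_seq (f : nat -> A -> seq (seq B)) :
  comp f -> comp (fun F x => head [::] (f F x)).
Proof. by move=> [e h]; exists (EComp ECar e) => N x /=; rewrite h; case: (f _ x). Qed.

Lemma comp_nilp (f : nat -> A -> seq B) : comp f -> comp (fun F x => nilp (f F x)).
Proof.
move=> [e h]; exists (EIf e ENil (EPair ENil ENil)) => N x /=.
by rewrite h; case: (f _ x).
Qed.

Lemma comp_case (l : nat -> A -> seq B) (f : nat -> A -> C)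
    (g : nat -> A -> B -> seq B -> C) :
  comp l -> comp f -> comp (fun F (p : A * (B * seq B)) => g F p.1 p.2.1 p.2.2) ->
  comp (fun F x => match l F x with [::] => f F x | y :: l' => g F x y l' end).
Proof.
move=> [e1 h1] [e2 h2] [e3 h3].
exists (EIf e1 (EComp e3 (EPair EId e1)) e2) => N x /=.
rewrite h1 h2; case el: (l _ x) => [|y l'] //=.
by rewrite -(h3 N (x, (y, l'))).
Qed.

(** Two nested [EIter] give N * N rounds. Expressions have no variables, so the loop state carries
    the environment [x] as its left component. *)
Lemma comp_iter (g : nat -> A -> B -> B) (a : nat -> A -> B) :
  comp (fun F (p : A * B) => g F p.1 p.2) -> comp a ->
  comp (fun F x => iter F (g F x) (a F x)).
Proof.
move=> [e1 h1] [e2 h2].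
exists (EComp ECdr (EComp (EIter (EIter (EPair ECar e1))) (EPair EId e2))) => N x /=.
rewrite h2 -iterM; move: (a _ x) => y.
have gen n : iter n (fun t => Node (tcar t) (eval N e1 t)) (Node (enc x) (enc y)) =
    Node (enc x) (enc (iter n (g (N * N) x) y)).
  elim: n => [//|n IH]; rewrite !iterS {}IH.
  by congr Node; apply: (h1 N (x, _)).
by rewrite (gen (N * N)).
Qed.

Lemma comp_0 : comp (fun _ (_ : A) => 0).
Proof. by exists ENil. Qed.

Lemma comp_succ (f : nat -> A -> nat) : comp f -> comp (fun F x => (f F x).+1).
Proof. by move=> [e h]; exists (EPair ENil e) => N x /=; rewrite h. Qed.

Lemma comp_pred (f : nat -> A -> nat) : comp f -> comp (fun F x => (f F x).-1).
Proof. by move=> [e h]; exists (EComp ECdr e) => N x /=; rewrite h; case: (f _ x). Qed.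

Lemma comp_eq0 (f : nat -> A -> nat) : comp f -> comp (fun F x => f F x == 0).
Proof.
move=> [e h]; exists (EIf e ENil (EPair ENil ENil)) => N x /=.
by rewrite h; case: (f _ x).
Qed.
End Comp.

Lemma comp_let A B C `{Enc A} `{Enc B} `{Enc C} (g : nat -> A -> B -> C) (f : nat -> A -> B) :
  comp f -> comp (fun F (p : A * B) => g F p.1 p.2) ->
  comp (fun F x => let y := f F x in g F x y).
Proof. by move=> cf cg; apply: (comp_comp cg (comp_pair comp_id cf)). Qed.

Lemma comp_and A `{Enc A} (f g : nat -> A -> bool) :
  comp f -> comp g -> comp (fun F x => f F x && g F x).
Proof. by move=> cf cg; apply: comp_if => //; apply: comp_false. Qed.

Lemma comp_not A `{Enc A} (f : nat -> A -> bool) :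
  comp f -> comp (fun F x => ~~ f F x).
Proof. by move=> cf; apply: comp_if => //; [apply: comp_false|apply: comp_true]. Qed.

Definition foldF A B F (f : B -> A -> B) a l := foldl f a (take F l).

(** A loop of fixed length idles on the empty list and abandons a list that is too long; [take F]
    describes both. *)
Lemma foldF_iter A B F (f : B -> A -> B) a l : foldF F f a l =
  (iter F (fun st => match st.1 with [::] => st | x :: l' => (l', f st.2 x) end) (l, a)).2.
Proof.
rewrite /foldF; elim: {1 2}F l a => [|n IH] l a; first by rewrite take0.
rewrite iterSr; case: l => [|x l] /=; last exact: IH.
by rewrite -IH.
Qed.

Lemma comp_foldF A B C `{Enc A} `{Enc B} `{Enc C} (f : nat -> C -> B -> A -> B)
    (a : nat -> C -> B) (l : nat -> C -> seq A) :
  comp (fun F (p : C * (B * A)) => f F p.1 p.2.1 p.2.2) -> comp a -> comp l ->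
  comp (fun F x => foldF F (f F x) (a F x) (l F x)).
Proof.
move=> cf ca cl.
enough (comp (fun F x =>
   (iter F (fun st => match st.1 with [::] => st | y :: l' => (l', f F x st.2 y) end)
     (l F x, a F x)).2)) as [e h] by (by exists e => N x; rewrite h -foldF_iter).
apply: comp_snd; apply: comp_iter; last exact: comp_pair.
apply: comp_case.
- by apply: comp_fst; apply: comp_snd; apply: comp_id.
- by apply: comp_snd; apply: comp_id.
apply: comp_pair; first by do 2!apply: comp_snd; apply: comp_id.
apply: (comp_comp (f := fun F (p : C * (seq A * B) * (A * seq A)) =>
   (p.1.1, (p.1.2.2, p.2.1))) cf).
apply: comp_pair; first by do 2!apply: comp_fst; apply: comp_id.
apply: comp_pair.
  by do 2!apply: comp_snd; apply: comp_fst; apply: comp_id.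
by apply: comp_fst; apply: comp_snd; apply: comp_id.
Qed.

Ltac comp_user := fail.

Ltac comp_step := first
  [ assumption
  | match goal with h : comp _ |- _ => eapply (comp_comp h) end
  | exact: comp_id | exact: comp_nil | exact: comp_true | exact: comp_false | exact: comp_0
  | simple eapply comp_pair | simple eapply comp_fst | simple eapply comp_snd
  | simple eapply comp_cons | simple eapply comp_behead
  | simple eapply comp_and | simple eapply comp_not | simple eapply comp_if
  | simple eapply comp_nilp | simple eapply comp_head_bool | simple eapply comp_head_seq
  | simple eapply comp_succ | simple eapply comp_pred | simple eapply comp_eq0
  | comp_user
  | simple eapply comp_case | simple eapply comp_let
  | simple eapply comp_foldF | simple eapply comp_iter ].

Ltac comp_solve := repeat comp_step.

(** * The program *)

Definition revF A F (l : seq A) := foldF F (fun r x => x :: r) [::] l.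

Definition mapF A B F (g : A -> B) (l : seq A) :=
  revF F (foldF F (fun r x => g x :: r) [::] l).

(** A ripple-carry adder, least significant bit first. It always emits [F] bits, so results are
    padded with zeros and only their values are used. *)
Definition addF F (x y : seq bool) : seq bool :=
  revF F (iter F (fun st : (seq bool * seq bool) * (bool * seq bool) =>
    let a := head false st.1.1 in let b := head false st.1.2 in
    ((behead st.1.1, behead st.1.2),
     if a then
       if b then (true, st.2.1 :: st.2.2) else (st.2.1, ~~ st.2.1 :: st.2.2)
     else
       if b then (st.2.1, ~~ st.2.1 :: st.2.2) else (false, st.2.1 :: st.2.2)))
   ((x, y), (false, [::]))).2.2.

Definition mulF F (x y : seq bool) : seq bool :=
  foldF F (fun acc (b : bool) => if b then addF F x (false :: acc) else false :: acc)
    [::] (revF F y).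

(** Bits come in order of increasing weight, so each differing pair overrides the verdict so far. *)
Definition ltF F (x y : seq bool) : bool :=
  (iter F (fun st : (seq bool * seq bool) * bool =>
    let a := head false st.1.1 in let b := head false st.1.2 in
    ((behead st.1.1, behead st.1.2),
     if a then (if b then st.2 else false) else (if b then true else st.2)))
   ((x, y), false)).2.

(** Unlike [addF], this returns the unpadded word: [iotaF] makes the names of agents with it, and
    these are printed in the output. *)
Definition incF F (x : seq bool) : seq bool :=
  let r := foldF F (fun (st : bool * seq bool) (b : bool) =>
    if st.1 then (if b then (true, false :: st.2) else (false, true :: st.2))
    else (false, b :: st.2)) (true, [::]) x in
  revF F (if r.1 then true :: r.2 else r.2).

Notation bits := (seq bool).
Notation qfrac := (bits * bits)%type.

(* Cross multiplication: [x.1 / x.2 <= y.1 / y.2]. *)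
Definition leqfracF F (x y : qfrac) : bool :=
  ~~ ltF F (mulF F y.1 x.2) (mulF F x.1 y.2).

Definition iotaF F (k : bits) : seq bits :=
  revF F (iter F (fun st : bits * seq bits =>
    if ltF F st.1 k then (incF F st.1, st.1 :: st.2) else st) ([::], [::])).2.

Definition tokensF F (w : bits) : seq bits :=
  revF F (iter F (fun st : bits * (bits * seq bits) =>
    match st.1 with
    | [::] => st
    | b :: w' => if b then (behead w', (head false w' :: st.2.1, st.2.2))
                 else (behead w', ([::], revF F st.2.1 :: st.2.2))
    end) (w, ([::], [::]))).2.2.

(** A rational occupies four tokens; the two signs are dropped, all rationals of an instance being
    nonnegative. *)
Definition fracsF F (ts : seq bits) : seq qfrac :=
  revF F (iter F (fun st : seq bits * seq qfrac =>
    if nilp st.1 then st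
    else (behead (behead (behead (behead st.1))),
          (head [::] (behead st.1), head [::] (behead (behead (behead st.1)))) :: st.2))
   (ts, [::])).2.

(** [cnt] matters only through its length: it is a number spelled out by [iotaF]. *)
Definition chunkF A F (cnt : seq bits) (l : seq A) : seq A * seq A :=
  let r := foldF F (fun (st : seq A * seq A) (_ : bits) =>
    match st.1 with [::] => st | x :: l' => (l', x :: st.2) end) (l, [::]) cnt in
  (revF F r.2, r.1).

Definition zipF A B F (a : seq A) (b : seq B) : seq (A * B) :=
  revF F (foldF F (fun (st : seq B * seq (A * B)) x =>
    match st.1 with [::] => st | y :: b' => (b', (x, y) :: st.2) end) (b, [::]) a).2.

Definition leqF F (a b : nat) : bool :=
  (iter F (fun st : nat * nat => if st.2 == 0 then st else (st.1.-1, st.2.-1)) (a, b)).1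
  == 0.

(* Agent and rank within the agent's bundle; whether the rank is one whose
   item must reach the threshold; the agent's values. *)
Notation slot := ((bits * bits) * (bool * seq qfrac))%type.

(** Each agent consumes one quantile and the next [m] values. Comparing the quantile with (j + 1) /
    k avoids computing a ceiling. *)
Definition slotsF F (n m k : bits) (taus vals : seq qfrac) : seq slot :=
  (foldF F (fun (st : (seq qfrac * seq qfrac) * seq slot) (i : bits) =>
     match st.1.1 with
     | [::] => st
     | tau :: taus' =>
       let r := chunkF F (iotaF F m) st.1.2 in
       ((taus', r.2),
        foldF F (fun (s : seq slot) (j : bits) =>
           ((i, j), (leqfracF F tau (incF F j, k), r.1)) :: s) st.2 (iotaF F k))
     end) ((taus, vals), [::]) (iotaF F n)).2.

(* A good carries its price and the list, of length at most one, of its owners. *)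
Notation good := (nat * seq slot)%type.

Definition acceptF F (x : qfrac) (u : slot) : seq bool :=
  mapF F (fun v => if u.2.1 then leqfracF F x v else true) u.2.2.

(** A list of length at most one plays the part of an option, here and in [bestF]. *)
Definition cheapestF F (z : seq (good * bool)) : seq nat :=
  foldF F (fun (b : seq nat) (g : good * bool) =>
    if g.2 then
      match b with
      | [::] => [:: g.1.1]
      | p :: _ => if leqF F p g.1.1 then b else [:: g.1.1]
      end
    else b) [::] z.

Definition placeF F (p : nat) (u : slot) (z : seq (good * bool)) :
    (bool * seq slot) * seq good :=
  let r := foldF F (fun (st : (bool * seq slot) * seq good) (g : good * bool) =>
    if ~~ st.1.1 && (g.2 && leqF F g.1.1 p) then
      ((true, g.1.2), (p.+1, [:: u]) :: st.2)
    else (st.1, g.1 :: st.2)) ((false, [::]), [::]) z in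
  (r.1, revF F r.2).

(** A slot that accepts no good blocks the queue for ever. This is harmless, for then no perfect
    matching exists and the queue should end nonempty. *)
Definition bidF F (x : qfrac) (st : seq slot * seq good) : seq slot * seq good :=
  match st.1 with
  | [::] => st
  | u :: us =>
    let z := zipF F st.2 (acceptF F x u) in
    match cheapestF F z with
    | [::] => st
    | p :: _ =>
      let r := placeF F p u z in
      (match r.1.2 with [::] => us | w :: _ => w :: us end, r.2)
    end
  end.

Definition auctionF F (x : qfrac) (us : seq slot) (items : seq bits) :
    seq slot * seq good :=
  iter F (bidF F x) (us, mapF F (fun _ : bits => (0, [::])) items).

Definition bestF F (us : seq slot) (items : seq bits) (cands : seq qfrac) :
    seq (qfrac * seq good) :=
  foldF F (fun (b : seq (qfrac * seq good)) (x : qfrac) =>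
    let r := auctionF F x us items in
    if nilp r.1 && (match b with [::] => true | y :: _ => leqfracF F y.1 x end)
    then [:: (x, r.2)] else b) [::] cands.

(** Built back to front, since the machine reverses what it prints. *)
Definition outputF F (gs : seq good) : bits :=
  foldF F (fun (out : bits) (g : good) =>
    match g.2 with
    | [::] => out
    | u :: _ => false :: false ::
        foldF F (fun (o : bits) (b : bool) => b :: true :: o) out u.1.1
    end) [::] gs.

Definition solveF F (n m k : bits) (fs : seq qfrac) : bits :=
  let r := chunkF F (iotaF F n) fs in
  let us := slotsF F n m k r.1 r.2 in
  match bestF F us (iotaF F m) r.2 with
  | [::] => [::]
  | y :: _ => outputF F y.2
  end.

Definition programF F (w : bits) : bits :=
  let ts := tokensF F (revF F w) in
  solveF F (head [::] ts) (head [::] (behead ts)) (head [::] (behead (behead ts)))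
    (fracsF F (behead (behead (behead ts)))).

Lemma comp_revF A B `{Enc A} `{Enc B} (f : nat -> A -> seq B) :
  comp f -> comp (fun F x => revF F (f F x)).
Proof. by move=> cf; rewrite /revF; comp_solve. Qed.

Ltac comp_user ::= simple eapply comp_revF.

Lemma comp_mapF A B C `{Enc A} `{Enc B} `{Enc C} (g : nat -> A -> B -> C)
    (l : nat -> A -> seq B) :
  comp (fun F (p : A * B) => g F p.1 p.2) -> comp l ->
  comp (fun F x => mapF F (g F x) (l F x)).
Proof.
move=> cg cl; rewrite /mapF; comp_solve.
apply: (comp_comp (f := fun F (p : A * (seq C * B)) => (p.1, p.2.2)) cg); comp_solve.
Qed.

Lemma comp_addF A `{Enc A} (f g : nat -> A -> bits) :
  comp f -> comp g -> comp (fun F x => addF F (f F x) (g F x)).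
Proof. by move=> cf cg; rewrite /addF; comp_solve. Qed.

Lemma comp_ltF A `{Enc A} (f g : nat -> A -> bits) :
  comp f -> comp g -> comp (fun F x => ltF F (f F x) (g F x)).
Proof. by move=> cf cg; rewrite /ltF; comp_solve. Qed.

Lemma comp_incF A `{Enc A} (f : nat -> A -> bits) :
  comp f -> comp (fun F x => incF F (f F x)).
Proof. by move=> cf; rewrite /incF; comp_solve. Qed.

Lemma comp_tokensF A `{Enc A} (f : nat -> A -> bits) :
  comp f -> comp (fun F x => tokensF F (f F x)).
Proof. by move=> cf; rewrite /tokensF; comp_solve. Qed.

Lemma comp_fracsF A `{Enc A} (f : nat -> A -> seq bits) :
  comp f -> comp (fun F x => fracsF F (f F x)).
Proof. by move=> cf; rewrite /fracsF; comp_solve. Qed.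

Lemma comp_leqF A `{Enc A} (f g : nat -> A -> nat) :
  comp f -> comp g -> comp (fun F x => leqF F (f F x) (g F x)).
Proof. by move=> cf cg; rewrite /leqF; comp_solve. Qed.

Lemma comp_chunkF A B `{Enc A} `{Enc B} (f : nat -> A -> seq bits) (g : nat -> A -> seq B) :
  comp f -> comp g -> comp (fun F x => chunkF F (f F x) (g F x)).
Proof. by move=> cf cg; rewrite /chunkF; comp_solve. Qed.

Lemma comp_zipF A B C `{Enc A} `{Enc B} `{Enc C} (f : nat -> A -> seq B) (g : nat -> A -> seq C) :
  comp f -> comp g -> comp (fun F x => zipF F (f F x) (g F x)).
Proof. by move=> cf cg; rewrite /zipF; comp_solve. Qed.

Lemma comp_outputF A `{Enc A} (f : nat -> A -> seq good) :
  comp f -> comp (fun F x => outputF F (f F x)).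
Proof. by move=> cf; rewrite /outputF; comp_solve. Qed.

Ltac comp_user ::= first
  [ simple eapply comp_revF | simple eapply comp_mapF | simple eapply comp_addF
  | simple eapply comp_ltF | simple eapply comp_incF
  | simple eapply comp_tokensF | simple eapply comp_fracsF | simple eapply comp_leqF
  | simple eapply comp_chunkF | simple eapply comp_zipF | simple eapply comp_outputF ].

Lemma comp_mulF A `{Enc A} (f g : nat -> A -> bits) :
  comp f -> comp g -> comp (fun F x => mulF F (f F x) (g F x)).
Proof. by move=> cf cg; rewrite /mulF; comp_solve. Qed.

Lemma comp_iotaF A `{Enc A} (f : nat -> A -> bits) :
  comp f -> comp (fun F x => iotaF F (f F x)).
Proof. by move=> cf; rewrite /iotaF; comp_solve. Qed.

Lemma comp_cheapestF A `{Enc A} (f : nat -> A -> seq (good * bool)) :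
  comp f -> comp (fun F x => cheapestF F (f F x)).
Proof. by move=> cf; rewrite /cheapestF; comp_solve. Qed.

Lemma comp_placeF A `{Enc A} (p : nat -> A -> nat) (u : nat -> A -> slot) (f : nat -> A -> seq (good * bool)) :
  comp p -> comp u -> comp f -> comp (fun F x => placeF F (p F x) (u F x) (f F x)).
Proof. by move=> cp cu cf; rewrite /placeF; comp_solve. Qed.

Ltac comp_user2 := first [ simple eapply comp_mulF | simple eapply comp_iotaF
  | simple eapply comp_cheapestF | simple eapply comp_placeF].

Lemma comp_leqfracF A `{Enc A} (f g : nat -> A -> qfrac) :
  comp f -> comp g -> comp (fun F x => leqfracF F (f F x) (g F x)).
Proof. by move=> cf cg; rewrite /leqfracF; repeat first [comp_user2|comp_step]. Qed.

Lemma comp_acceptF A `{Enc A} (f : nat -> A -> qfrac) (g : nat -> A -> slot) :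
  comp f -> comp g -> comp (fun F x => acceptF F (f F x) (g F x)).
Proof.
move=> cf cg; rewrite /acceptF; repeat first [simple eapply comp_leqfracF|comp_step].
Qed.

Lemma comp_slotsF A `{Enc A} (n m k : nat -> A -> bits) (f g : nat -> A -> seq qfrac) :
  comp n -> comp m -> comp k -> comp f -> comp g ->
  comp (fun F x => slotsF F (n F x) (m F x) (k F x) (f F x) (g F x)).
Proof.
move=> cn cm ck cf cg; rewrite /slotsF.
by repeat first [simple eapply comp_leqfracF|comp_user2|comp_step].
Qed.

Ltac comp_user3 := first [ simple eapply comp_leqfracF | simple eapply comp_acceptF
  | simple eapply comp_slotsF | comp_user2].

Lemma comp_bidF A `{Enc A} (f : nat -> A -> qfrac) (g : nat -> A -> seq slot * seq good) :
  comp f -> comp g -> comp (fun F x => bidF F (f F x) (g F x)).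
Proof. by move=> cf cg; rewrite /bidF; repeat first [comp_user3|comp_step]. Qed.

Lemma comp_auctionF A `{Enc A} (f : nat -> A -> qfrac) (u : nat -> A -> seq slot)
    (g : nat -> A -> seq bits) :
  comp f -> comp u -> comp g -> comp (fun F x => auctionF F (f F x) (u F x) (g F x)).
Proof.
by move=> cf cu cg; rewrite /auctionF; repeat first [simple eapply comp_bidF|comp_user3|comp_step].
Qed.

Lemma comp_bestF A `{Enc A} (u : nat -> A -> seq slot)
    (g : nat -> A -> seq bits) (f : nat -> A -> seq qfrac) :
  comp u -> comp g -> comp f -> comp (fun F x => bestF F (u F x) (g F x) (f F x)).
Proof.
by move=> cu cg cf; rewrite /bestF; repeat first [simple eapply comp_auctionF|comp_user3|comp_step].
Qed.

Lemma comp_solveF A `{Enc A} (n m k : nat -> A -> bits) (f : nat -> A -> seq qfrac) :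
  comp n -> comp m -> comp k -> comp f ->
  comp (fun F x => solveF F (n F x) (m F x) (k F x) (f F x)).
Proof.
move=> cn cm ck cf; rewrite /solveF.
by repeat first [simple eapply comp_bestF|comp_user3|comp_step].
Qed.

Lemma comp_programF : comp programF.
Proof.
rewrite /programF; repeat first [simple eapply comp_solveF|comp_user3|comp_step].
Qed.

(** * List functions computed by loops with enough fuel *)

Lemma foldFE A B F (f : B -> A -> B) a l : size l <= F -> foldF F f a l = foldl f a l.
Proof. by move=> le; rewrite /foldF take_oversize. Qed.

Lemma foldl_cons A (l r : seq A) : foldl (fun r x => x :: r) r l = rev l ++ r.
Proof. by elim: l r => //= x l IH r; rewrite IH rev_cons cat_rcons. Qed.

Lemma revFE A F (l : seq A) : size l <= F -> revF F l = rev l.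
Proof. by move=> le; rewrite /revF foldFE // foldl_cons cats0. Qed.

Lemma mapFE A B F (g : A -> B) l : size l <= F -> mapF F g l = map g l.
Proof.
move=> le; rewrite /mapF foldFE //.
have -> : foldl (fun r x => g x :: r) [::] l = rev (map g l).
  by rewrite -[RHS]cats0 -foldl_cons; elim: l [::] {le} => //= x l IH r.
by rewrite revFE ?revK // size_rev size_map.
Qed.

Lemma chunkFE A F cnt (l : seq A) : size cnt <= F ->
  chunkF F cnt l = (take (size cnt) l, drop (size cnt) l).
Proof.
move=> le; rewrite /chunkF foldFE //=.
set f := fun _ _ => _.
suff -> : foldl f (l, [::]) cnt = (drop (size cnt) l, rev (take (size cnt) l)).
  by rewrite revFE ?revK // size_rev size_take_min (leq_trans (geq_minl _ _)).
have -> : rev (take (size cnt) l) = rev (take (size cnt) l) ++ [::] by rewrite cats0.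
elim: cnt l [::] {le} => [|c cnt IH] [|x l] r //=.
  by elim: cnt {IH} => //= c' cnt ->.
by rewrite /f /= -/f IH rev_cons cat_rcons.
Qed.

Lemma zipFE A B F (a : seq A) (b : seq B) : size a <= F -> zipF F a b = zip a b.
Proof.
move=> le; rewrite /zipF foldFE //.
set f := fun _ _ => _.
suff -> : (foldl f (b, [::]) a).2 = rev (zip a b).
  by rewrite revFE ?revK // size_rev size_zip (leq_trans (geq_minl _ _)).
have -> : rev (zip a b) = rev (zip a b) ++ [::] by rewrite cats0.
elim: a b [::] {le} => [|x a IH] [|y b] r //=.
  have -> : f ([::], r) x = ([::], r) by [].
  by elim: a {IH} => [|x' a IH] //=; case: (a) IH.
have -> : f (y :: b, r) x = (b, (x, y) :: r) by [].
by rewrite IH rev_cons cat_rcons.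
Qed.

(** * Binary arithmetic *)

Fixpoint bval (x : bits) : nat := if x is b :: x' then b + (bval x').*2 else 0.

Lemma bval_head_behead x : bval x = head false x + (bval (behead x)).*2.
Proof. by case: x. Qed.

Lemma bval_lt x : bval x < 2 ^ size x.
Proof. by elim: x => //= b x IH; rewrite expnS; case: b; lia. Qed.

Fixpoint bsucc (x : bits) : bits := match x with
  | [::] => [:: true]
  | false :: x' => true :: x'
  | true :: x' => false :: bsucc x'
  end.

Lemma pos_bits_succ p : pos_bits (Pos.succ p) = bsucc (pos_bits p).
Proof. by elim: p => //= p ->. Qed.

Lemma nat_bits_succ j : nat_bits j.+1 = bsucc (nat_bits j).
Proof.
rewrite /nat_bits Nnat.Nat2N.inj_succ; case: (N.of_nat j) => //= p.
exact: pos_bits_succ.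
Qed.

Lemma bval_bsucc x : bval (bsucc x) = (bval x).+1.
Proof. by elim: x => [|[] x IH] //=; rewrite IH; lia. Qed.

Lemma bval_nat_bits j : bval (nat_bits j) = j.
Proof. by elim: j => // j IH; rewrite nat_bits_succ bval_bsucc IH. Qed.

Lemma nat_bits_inj : injective nat_bits.
Proof. exact: can_inj bval_nat_bits. Qed.

Lemma size_bsucc x : size x <= size (bsucc x).
Proof. by elim: x => [|[] x IH] //=; lia. Qed.

Lemma size_nat_bits_le i j : i <= j -> size (nat_bits i) <= size (nat_bits j).
Proof.
elim: j => [|j IH]; first by rewrite leqn0 => /eqP ->.
rewrite leq_eqVlt => /orP[/eqP -> //|/IH le].
by rewrite nat_bits_succ; apply: leq_trans le (size_bsucc _).
Qed.

Lemma incFE F x : size x < F -> incF F x = bsucc x.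
Proof.
move=> lt; rewrite /incF foldFE; last exact: ltnW.
set f := fun _ _ => _.
set r := foldl _ _ _.
suff -> : (if r.1 then true :: r.2 else r.2) = rev (bsucc x).
  rewrite revFE ?revK // size_rev.
  by apply: leq_trans lt; elim: (x) => [|[] y IH] //=.
rewrite {}/r {lt F}.
have g0 y o : foldl f (false, o) y = (false, rev y ++ o).
  by elim: y o => //= b y IH o; rewrite /f /= -/f IH rev_cons cat_rcons.
have -> : rev (bsucc x) = rev (bsucc x) ++ [::] by rewrite cats0.
elim: x [::] => [|[] x IH] o //=; rewrite {2 4}/f /=.
  by rewrite rev_cons cat_rcons -IH.
by rewrite /= g0 rev_cons cat_rcons.
Qed.

(** Splits the lowest bit off a residue: the induction step for operations on words of fixed
    width. *)
Lemma modn_bit (b : bool) m n : (b + m.*2) %% 2 ^ n.+1 = b + (m %% 2 ^ n).*2.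
Proof.
have lt : m %% 2 ^ n < 2 ^ n by rewrite ltn_mod expn_gt0.
rewrite {1}(divn_eq m (2 ^ n)) expnS.
have -> : b + (m %/ 2 ^ n * 2 ^ n + m %% 2 ^ n).*2 =
  m %/ 2 ^ n * (2 * 2 ^ n) + (b + (m %% 2 ^ n).*2) by lia.
by rewrite modnMDl modn_small //; move: lt; case: b; lia.
Qed.

Lemma ltFE F x y : ltF F x y = (bval x %% 2 ^ F < bval y %% 2 ^ F).
Proof.
rewrite /ltF; set f := (fun st : (bits * bits) * bool => _).
have f3 a r : f (a, r) = ((behead a.1, behead a.2), (f (a, r)).2) by [].
(* The verdict [r] on lower bits breaks ties: when it is true, the strict comparison of the
   remaining bits becomes a weak one. *)
suff H r : (iter F f ((x, y), r)).2 =
    (bval x %% 2 ^ F + ~~ r < bval y %% 2 ^ F + 1).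
  by rewrite H /= !addn1 ltnS.
elim: F x y r => [|F IH] x y r; first by rewrite /= !modn1; case: r.
rewrite iterSr f3 IH (bval_head_behead x) (bval_head_behead y) !modn_bit /f /=.
by case: (head _ x); case: (head _ y); case: r => /=; lia.
Qed.

Lemma addFE F x y : bval (addF F x y) = (bval x + bval y) %% 2 ^ F.
Proof.
rewrite /addF; set f := (fun st : (bits * bits) * (bool * bits) => _).
have sz n s : size (iter n f s).2.2 = n + size s.2.2.
  elim: n => //= n IH; rewrite addSn -IH.
  by rewrite /f; case: (head _ _); case: (head _ _).
rewrite revFE ?sz ?addn0 // {sz}.
have f3 (a : qfrac) (c : bool) (o : bits) : f (a, (c, o)) = ((behead a.1, behead a.2), ((f (a, (c, o))).2.1,
    (head false a.1 (+) head false a.2 (+) c) :: o)).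
  by rewrite /f; case: (head _ _); case: (head _ _); case: c.
have f4 (a : qfrac) (c : bool) (o : bits) : head false a.1 + head false a.2 + c =
   (head false a.1 (+) head false a.2 (+) c) + (f (a, (c, o))).2.1.*2.
  by rewrite /f; case: (head _ _); case: (head _ _); case: c.
suff H (c : bool) (o : bits) : exists2 z, rev (iter F f ((x, y), (c, o))).2.2 = rev o ++ z &
    bval z = (bval x + bval y + c) %% 2 ^ F.
  by have [z -> ->] := H false [::]; rewrite addn0.
elim: F x y c o => [|F IH] x y c o; first by exists [::]; rewrite ?cats0 //= modn1.
rewrite iterSr f3.
have [z -> vz] := IH (behead x) (behead y) (f ((x, y), (c, o))).2.1
  ((head false x (+) head false y (+) c) :: o).
eexists; first by rewrite rev_cons cat_rcons.
rewrite /= vz -modn_bit (bval_head_behead x) (bval_head_behead y).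
congr (_ %% _); have /= := f4 (x, y) c o; lia.
Qed.

Lemma mulFE F x y : size y <= F -> bval x * bval y < 2 ^ F ->
  bval (mulF F x y) = bval x * bval y.
Proof.
move=> le; rewrite /mulF revFE // foldFE ?size_rev //.
rewrite foldl_rev; elim: y {le} => [|b y IH] /= lt; first by rewrite muln0.
have lt2 : bval x * bval y < 2 ^ F by apply: leq_ltn_trans lt; nia.
set z := foldr _ _ _ in IH *.
have vz : bval (false :: z) = (bval x * bval y).*2 by rewrite /= IH.
case: b lt => lt; last by rewrite vz; lia.
rewrite addFE vz modn_small; first by lia.
by apply: leq_trans lt; nia.
Qed.

(** The size hypotheses keep both products below 2^F, so that truncation to [F] bits changes
    neither. *)
Lemma leqfracFE F x y :
  size x.1 + size y.2 <= F -> size y.1 + size x.2 <= F ->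
  leqfracF F x y = (bval x.1 * bval y.2 <= bval y.1 * bval x.2).
Proof.
have pow a b c : size a + size b <= c -> bval a * bval b < 2 ^ c.
  move=> le; apply: (@leq_trans (2 ^ (size a + size b))); last by rewrite leq_exp2l.
  by rewrite expnD; have := bval_lt a; have := bval_lt b; nia.
move=> le1 le2; have lt1 := pow _ _ _ le1; have lt2 := pow _ _ _ le2.
rewrite /leqfracF ltFE -leqNgt !mulFE ?modn_small //; lia.
Qed.

Lemma iotaFE F k : size (nat_bits k) < F -> k <= F ->
  iotaF F (nat_bits k) = [seq nat_bits j | j <- iota 0 k].
Proof.
move=> ltk lek; rewrite /iotaF; set f := (fun st : bits * seq bits => _).
have small j : j <= k -> bval (nat_bits j) %% 2 ^ F = j.
  move=> le; rewrite modn_small ?bval_nat_bits //.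
  have := bval_lt (nat_bits k); rewrite bval_nat_bits => lt.
  have : 2 ^ size (nat_bits k) <= 2 ^ F by rewrite leq_exp2l // ltnW.
  lia.
have H t : iter t f ([::], [::]) =
    (nat_bits (minn t k), rev [seq nat_bits j | j <- iota 0 (minn t k)]).
  elim: t => [|t IH]; first by rewrite min0n.
  rewrite iterS IH /f /= ltFE !small ?geq_minr //.
  have [lt|ge] := ltnP t k.
    have -> : minn t.+1 k = t.+1 by lia.
    rewrite ?lt incFE; last first.
      by apply: leq_ltn_trans ltk; apply: size_nat_bits_le; exact: ltnW.
    rewrite -nat_bits_succ -[t.+1 in RHS]addn1 iotaD map_cat rev_cat /= addn1.
    by [].
  have -> : minn t.+1 k = k by lia.
  by rewrite ?ltnn.
rewrite H /= (minn_idPr lek) revFE ?revK //.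
by rewrite size_rev size_map size_iota.
Qed.

Lemma leqFE F a b : b <= F -> leqF F a b = (a <= b).
Proof.
rewrite /leqF; set f := (fun st : nat * nat => _).
elim: F a b => [|F IH] a b le.
  by move: le; rewrite leqn0 => /eqP->; rewrite leqn0.
rewrite iterSr /f /= -/f; case: b le => [|b] le /=; first by rewrite IH //; case: a.
by rewrite IH //; case: a.
Qed.

(** * Parsing *)

Lemma size_fields_ge ts t : t \in ts -> size t <= size (fields ts).
Proof.
elim: ts => //= t' ts IH; rewrite inE /fields /= size_cat size_field.
by move=> /orP[/eqP->|/IH]; rewrite /fields; lia.
Qed.

Lemma size_fields_count ts : (size ts).*2 <= size (fields ts).
Proof.
by elim: ts => //= t ts IH; rewrite /fields /= size_cat size_field; move: IH; rewrite /fields; lia.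
Qed.

Lemma tokensFE F ts : size (fields ts) <= F -> tokensF F (fields ts) = ts.
Proof.
move=> leF; rewrite /tokensF; set f := (fun st : bits * (bits * seq bits) => _).
have idle n o : iter n f ([::], o) = ([::], o) by elim: n => //= n ->.
(* One round per payload bit, which has two symbols, and one for the terminator [00]. *)
have one t r c o : size t + size c <= F ->
    iter (size t).+1 f (field t ++ r, (c, o)) = (r, ([::], (rev c ++ t) :: o)).
  elim: t c => [|b t IH] c le.
    by rewrite /= /f /= revFE // cats0.
  rewrite iterSr (_ : f _ = (field t ++ r, (b :: c, o))) //.
  by rewrite IH ?rev_cons ?cat_rcons //=; move: le => /=; lia.
suff H n o : size (fields ts) <= n ->
    iter n f (fields ts, ([::], o)) = ([::], ([::], rev ts ++ o)).
  rewrite H // cats0 /= revFE ?revK // size_rev.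
  by have := size_fields_count ts; lia.
elim: ts leF n o => [|t ts IH] leF n o; first by rewrite idle.
rewrite [fields (t :: ts)]/(field t ++ fields ts) size_cat size_field in leF *.
move=> len; have -> : n = (n - (size t).+1) + (size t).+1 by lia.
rewrite iterD one /=; last by lia.
rewrite IH ?rev_cons ?cat_rcons //; lia.
Qed.

Lemma fracsFE F (gs : seq (bits * qfrac * bits)) : size gs <= F ->
  fracsF F (flatten [seq [:: g.1.1; g.1.2.1; g.2; g.1.2.2] | g <- gs]) =
  [seq g.1.2 | g <- gs].
Proof.
move=> le; rewrite /fracsF; set f := (fun st : seq bits * seq qfrac => _).
have H n o : size gs <= n ->
    iter n f (flatten [seq [:: g.1.1; g.1.2.1; g.2; g.1.2.2] | g <- gs], o) =
    ([::], rev [seq g.1.2 | g <- gs] ++ o).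
  elim: gs n o {le} => [|[[s [p q]] s'] gs IH] [|n] o //= le; last first.
    by rewrite -iterS iterSr {2}/f /= IH // rev_cons cat_rcons.
  by rewrite /f /=; elim: n {le} => //= n ->.
rewrite H // cats0 revFE ?revK // size_rev size_map //.
Qed.

(** * The auction *)

Lemma cheapestFE F (z : seq (good * bool)) :
  size z <= F -> all (fun g => g.1.1 <= F) z ->
  (cheapestF F z = [::] /\ ~~ has snd z) \/
  exists p, [/\ cheapestF F z = [:: p], has (fun g => g.2 && (g.1.1 == p)) z
              & all (fun g => g.2 ==> (p <= g.1.1)) z].
Proof.
move=> le; rewrite /cheapestF foldFE // => {le}.
elim/last_ind: z => [_|z g IH]; first by left.
rewrite all_rcons => /andP[leg /IH {}IH]; rewrite foldl_rcons.
case: IH => [[-> /negbTE hz]|[p [-> hz az]]]; case eg: g.2.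
- right; exists g.1.1; split=> //.
    by rewrite has_rcons eg eqxx.
  rewrite all_rcons leqnn implybT /=; apply/allP => g' g'z.
  by apply/implyP => eg'; move/hasPn: (negbT hz) => /(_ _ g'z); rewrite eg'.
- by left; rewrite has_rcons eg hz.
- right; rewrite leqFE //; have [lep|ltp] := leqP p g.1.1.
    exists p; split=> //; first by rewrite has_rcons hz orbT.
    by rewrite all_rcons az lep implybT.
  exists g.1.1; split=> //; first by rewrite has_rcons eg eqxx.
  rewrite all_rcons leqnn implybT /=; apply: sub_all az => g'.
  by case: g'.2 => //=; lia.
- right; exists p; split=> //; first by rewrite has_rcons hz orbT.
  by rewrite all_rcons eg az.
Qed.

Lemma placeFE F p u (z1 z2 : seq (good * bool)) g :
  p <= F -> size (z1 ++ g :: z2) <= F ->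
  all (fun g => ~~ (g.2 && (g.1.1 <= p))) z1 -> g.2 && (g.1.1 <= p) ->
  placeF F p u (z1 ++ g :: z2) =
  ((true, g.1.2), map fst z1 ++ (p.+1, [:: u]) :: map fst z2).
Proof.
move=> lep le al hg; rewrite /placeF foldFE //; set f := fun _ _ => _.
have f1 o r z : foldl f ((true, o), r) z = ((true, o), rev (map fst z) ++ r).
  by elim: z r => //= g' z IH r; rewrite IH rev_cons cat_rcons.
have f0 r : foldl f ((false, [::]), r) z1 = ((false, [::]), rev (map fst z1) ++ r).
  elim: z1 r al {le} => //= g' z IH r /andP[n1 n2].
  by rewrite /f /= leqFE // (negbTE n1) -/f IH // rev_cons cat_rcons.
have fg r : f ((false, [::]), r) g = ((true, g.1.2), (p.+1, [:: u]) :: r).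
  by rewrite /f /= leqFE // hg.
rewrite foldl_cat f0 /= fg f1 /= cats0 revFE.
  by rewrite rev_cat rev_cons !revK cat_rcons.
rewrite size_cat /= !size_rev !size_map.
by move: le; rewrite size_cat /=; lia.
Qed.

Definition head_cons A (l r : seq A) := match l with [::] => r | w :: _ => w :: r end.

Lemma flatten_filter_subseq A (T : eqType) (f : A -> seq T) p s :
  subseq (flatten (map f (filter p s))) (flatten (map f s)).
Proof.
elim: s => //= x s IH; case: (p x) => /=; first exact: cat_subseq.
by apply: subseq_trans IH (suffix_subseq _ _).
Qed.

Section Auction.
Variables (F : nat) (x : qfrac) (m : nat) (S : seq slot).
Hypotheses (uniqS : uniq S) (sizeS : size S = m) (leF : m <= F).
Let acc u := acceptF F x u.
Hypothesis sizeacc : forall u, u \in S -> size (acc u) = m.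

Let d0 : good := (0, [::]).
Local Notation owner gs i := (nth d0 gs i).2.
Local Notation price gs i := (nth d0 gs i).1.

(** The last clause is complementary slackness up to one unit. The third keeps prices within the
    fuel of the comparison [leqF]. *)
Definition inv t (st : seq slot * seq good) := let: (us, gs) := st in
  [/\ size gs = m, perm_eq (us ++ flatten (map snd gs)) S,
     forall i, i < m -> price gs i <= t,
     forall i, i < m -> size (owner gs i) <= 1 /\
       (owner gs i = [::] -> price gs i = 0) &
     forall i w, i < m -> w \in owner gs i -> nth false (acc w) i /\
       forall j, j < m -> nth false (acc w) j -> price gs i <= (price gs j).+1].

Lemma bidFE u us gs : size gs = m -> size (acc u) = m ->
  (forall i, i < m -> price gs i <= F) ->
  bidF F x (u :: us, gs) = (u :: us, gs) /\ (forall j, j < m -> ~~ nth false (acc u) j) \/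
  exists i, [/\ i < m, nth false (acc u) i,
    forall j, j < m -> nth false (acc u) j -> price gs i <= price gs j &
    bidF F x (u :: us, gs) =
      (head_cons (owner gs i) us, set_nth d0 gs i ((price gs i).+1, [:: u]))].
Proof.
move=> sg sa lep; set z := zip gs (acc u).
have -> : bidF F x (u :: us, gs) = match cheapestF F z with
    | [::] => (u :: us, gs)
    | p :: _ => (head_cons (placeF F p u z).1.2 us, (placeF F p u z).2)
    end by rewrite /z -(@zipFE _ _ F) ?sg.
have sz : size z = m by rewrite size_zip sg sa minnn.
have nz i : i < m -> nth (d0, false) z i = (nth d0 gs i, nth false (acc u) i).
  by move=> lt; rewrite nth_zip ?sg ?sa.
have az : all (fun g => g.1.1 <= F) z.
  by apply/(all_nthP (d0, false)) => i; rewrite sz => lt; rewrite nz //=; apply: lep.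
have [|[-> nh]|[p [-> hz minp]]] := cheapestFE _ az; first by rewrite sz.
  left; split=> // j lt; apply: contra nh => aj.
  by apply/(has_nthP (d0, false)); exists j; rewrite ?sz // nz.
right; set P := fun g : good * bool => g.2 && (g.1.1 <= p).
have hP : has P z.
  by apply: sub_has hz => g /andP[g2 /eqP g1]; rewrite /P g2 g1 leqnn.
have [i lti [Pi before]] : exists2 i, i < m & P (nth (d0, false) z i) /\
    all (fun g => ~~ P g) (take i z).
  exists (find P z); first by rewrite -sz -has_find.
  split; first exact: nth_find.
  apply/(all_nthP (d0, false)) => j; rewrite size_take -has_find hP => lt.
  by rewrite nth_take // before_find.
have ez : z = take i z ++ nth (d0, false) z i :: drop i.+1 z.
  by rewrite -drop_nth ?sz // cat_take_drop.
have minp' j : j < m -> nth false (acc u) j -> p <= price gs j.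
  move=> lt aj; have /(all_nthP (d0, false)) := minp.
  by move=> /(_ j); rewrite sz nz //= => /(_ lt); rewrite aj.
have /andP[ai lepi] : nth false (acc u) i && (price gs i <= p).
  by move: Pi; rewrite /P nz.
have ep : p = price gs i by apply/eqP; rewrite eqn_leq lepi minp'.
exists i; split=> //; first by move=> j lt aj; rewrite -ep minp'.
have pF : p <= F by rewrite ep lep.
have -> : placeF F p u z = ((true, owner gs i),
    set_nth d0 gs i ((price gs i).+1, [:: u])).
  have hs : size (take i z ++ nth (d0, false) z i :: drop i.+1 z) <= F.
    by rewrite -ez sz.
  have hg : (nth (d0, false) z i).2 && ((nth (d0, false) z i).1.1 <= p).
    by rewrite nz //= ai.
  rewrite [in LHS]ez (placeFE _ pF hs before hg) nz // set_nthE sg lti.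
  rewrite map_take map_drop.
  by rewrite -[map fst z]/(unzip1 z) unzip1_zip ?sg ?sa // ep.
by [].
Qed.

(** Raising one price cannot hurt the owners of other goods, and the new owner took a cheapest good,
    so the raise by one uses up exactly the slack allowed. *)
Lemma inv_step t st : t < F -> inv t st -> inv t.+1 (bidF F x st).
Proof.
case: st => -[|u us] gs ltF [sg pe lep ow ac].
  by split=> // i lt; apply: ltnW; apply: lep.
have uS : u \in S by rewrite -(perm_mem pe) mem_head.
have [|[-> _]|[i [lti ai mini ->]]] := @bidFE u us gs sg (sizeacc uS).
- by move=> j lt; have := lep j lt; lia.
- by split=> // j lt; apply: ltnW; apply: lep.
set gs' := set_nth _ _ _ _.
have ng j : nth d0 gs' j = if j == i then ((price gs i).+1, [:: u]) else nth d0 gs j.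
  by rewrite nth_set_nth.
have lepp j : price gs j <= price gs' j.
  by rewrite ng; case: eqP => [->|] //=.
split.
- by rewrite size_set_nth sg; apply/maxn_idPr.
- apply: perm_trans pe; rewrite /gs' set_nthE sg lti.
  have eg : gs = take i gs ++ nth d0 gs i :: drop i.+1 gs.
    by rewrite -drop_nth ?sg // cat_take_drop.
  rewrite [in X in perm_eq _ X]eg.
  have [s1 _] := ow i lti.
  rewrite !map_cat !flatten_cat /=; apply/permP => P.
  rewrite /head_cons; case: (owner gs i) s1 => [|w [|]] //= _.
    by rewrite !count_cat /= ?count_cat /=; lia.
  by rewrite !count_cat /= ?count_cat /=; lia.
- move=> j lt; rewrite ng; case: eqP => [_|_] /=; first by rewrite ltnS lep.
  by apply: ltnW; apply: lep.
- by move=> j lt; rewrite ng; case: eqP => // _; apply: ow.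
move=> j w lt; rewrite ng; case: eqP => [->|_] /=.
  rewrite inE => /eqP ->; split=> // j' lt' aj'.
  by rewrite ltnS; apply: leq_trans (lepp j'); apply: mini.
move=> wj; have [a1 a2] := ac j w lt wj; split=> // j' lt' aj'.
by apply: leq_trans (a2 j' lt' aj') _; rewrite ltnS.
Qed.

Variable items : seq bits.
Hypothesis sizeitems : size items = m.

Let st0 : seq slot * seq good := (S, mapF F (fun _ : bits => (0, [::])) items).

Lemma inv0 : inv 0 st0.
Proof.
have n0 i : nth d0 st0.2 i = d0.
  rewrite /= mapFE ?sizeitems //; have [lt|ge] := ltnP i m.
    by rewrite (nth_map [::]) ?sizeitems.
  by rewrite nth_default // size_map sizeitems.
split=> [||i _|i _|i w _].
- by rewrite /= mapFE ?size_map ?sizeitems.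
- rewrite /= mapFE ?sizeitems // -map_comp.
  suff -> : flatten (map (snd \o (fun _ : bits => d0)) items) = [::] by rewrite cats0.
  by elim: (items).
- by rewrite n0.
- by rewrite n0.
- by rewrite n0.
Qed.

Lemma inv_iter t : t <= F -> inv t (iter t (bidF F x) st0).
Proof.
elim: t => [|t IH] lt; first exact: inv0.
by rewrite iterS; apply: inv_step => //; apply: IH; apply: ltnW.
Qed.

(** The slot at position [g] of [ts] is the one matched to good [g]. *)
Definition matching (ts : seq slot) := perm_eq ts S /\
  forall g, g < m -> nth false (acc (nth (([::], [::]), (false, [::])) ts g)) g.

(** With an empty queue, m slots own m goods, at most one slot per good, so every good has exactly
    one owner. *)
Lemma auction_sound : (auctionF F x S items).1 = [::] ->
  exists2 ts, matching ts & map snd (auctionF F x S items).2 = [seq [:: u] | u <- ts].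
Proof.
have := inv_iter (leqnn F); rewrite -/(auctionF F x S items).
case: (auctionF _ _ _ _) => us gs [sg pe lep ow ac] /= us0.
rewrite {}us0 /= in pe.
have [ts ets] : exists ts, map snd gs = [seq [:: u] | u <- ts].
  have le1 g : g \in gs -> size g.2 <= 1.
    by move=> gin; have [] := ow (index g gs); rewrite -?sg ?index_mem // nth_index.
  have : size (flatten (map snd gs)) = size gs by rewrite (perm_size pe) sizeS sg.
  elim: (gs) le1 => [_ _|[p o] gs' IH le1 /=]; first by exists [::].
  rewrite size_cat => e.
  have leo : size o <= 1 by apply: (le1 (p, o)); rewrite mem_head.
  have le1' g : g \in gs' -> size g.2 <= 1.
    by move=> gin; apply: le1; rewrite inE gin orbT.
  have lef : size (flatten (map snd gs')) <= size gs'.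
    elim: (gs') le1' {IH e le1} => //= g gs2 IH le1'; rewrite size_cat.
    have lg := le1' g (mem_head _ _).
    suff : size (flatten (map snd gs2)) <= size gs2 by lia.
    by apply: IH => g' h; apply: le1'; rewrite inE h orbT.
  have [|ts ->] := IH le1'; first by lia.
  by case: o leo e {le1} => [|w [|]] //=; [lia|exists (w :: ts)].
exists ts => //.
have eS : flatten (map snd gs) = ts.
  by rewrite ets; elim: (ts) => //= u ts' ->.
rewrite eS in pe; split=> // g lt.
have lt' : g < size ts by rewrite (perm_size pe) sizeS.
have [|a _] := ac g (nth (([::], [::]), (false, [::])) ts g) lt; last by [].
suff -> : owner gs g = [:: nth (([::], [::]), (false, [::])) ts g] by rewrite mem_head.
by rewrite -(nth_map d0 [::] snd) ?sg // ets (nth_map (([::], [::]), (false, [::]))).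
Qed.

(* If the price of the good matched to a queued slot were at least [m], then
   among the slots whose matched good has price at least [l], there would be
   more than [m - l]: every good of positive price is owned, and the owner of
   a good of price at least [l] is matched to a good of price at least [l - 1]. *)
Lemma queued_price ts t us gs u : matching ts -> inv t (us, gs) -> u \in us ->
  price gs (index u ts) < m.
Proof.
move=> [pts ats] [sg pe lep ow ac] uus; rewrite ltnNge; apply/negP => ge.
have st : size ts = m by rewrite (perm_size pts).
have uts : uniq ts by rewrite (perm_uniq pts).
have imem w : w \in S -> index w ts < m by rewrite -(perm_mem pts) -index_mem st.
have iacc w : w \in S -> nth false (acc w) (index w ts).
  move=> wS; have := ats _ (imem _ wS).
  by rewrite nth_index // (perm_mem pts).
pose R l := fun w => l <= price gs (index w ts).
pose c l := count (fun g : good => l <= g.1) gs.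
have r_le_c l : count (R l) S <= c l.
  rewrite -size_filter -(size_map (index ^~ ts)).
  have -> : c l = size [seq i <- iota 0 m | l <= price gs i].
    rewrite size_filter /c -{1}(mkseq_nth d0 gs) sg /mkseq count_map.
    by apply: eq_count.
  apply: uniq_leq_size.
    rewrite map_inj_in_uniq ?filter_uniq // => w1 w2.
    rewrite !mem_filter => /andP[_ w1S] /andP[_ w2S] e.
    by rewrite -(nth_index w1 (s := ts) (x := w1)) ?(perm_mem pts) // e nth_index // (perm_mem pts).
  move=> i /mapP[w]; rewrite mem_filter => /andP[Rw wS] ->.
  by rewrite mem_filter mem_iota /= imem // andbT; exact: Rw.
(* By slackness all owners of goods of price at least [l] lie in [R l.-1]; the queued [u] owns
   nothing but lies there too and is the extra one. *)
have c_lt_r l : 0 < l -> l <= m -> c l < count (R l.-1) S.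
  move=> l0 lm.
  pose gl := [seq g <- gs | l <= g.1].
  have -> : c l = size (flatten (map snd gl)).
    rewrite /c -size_filter -/gl.
    have : forall g, g \in gl -> size g.2 = 1.
      move=> g; rewrite mem_filter => /andP[lg gin].
      have lti : index g gs < m by rewrite -sg index_mem.
      have [s1 s0] := ow _ lti; rewrite nth_index // in s1 s0.
      by case: g.2 s1 s0 => [|w [|]] //= _ /(_ erefl); lia.
    elim: (gl) => //= g gl' IH h.
    by rewrite size_cat h ?mem_head // -IH // => g' g'in; apply: h; rewrite inE g'in orbT.
  rewrite -size_filter.
  have uu : uniq (us ++ flatten (map snd gs)) by rewrite (perm_uniq pe).
  have sub := flatten_filter_subseq snd (fun g : good => l <= g.1) gs.
  rewrite -/gl in sub.
  have : uniq (u :: flatten (map snd gl)).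
    move: uu; rewrite cat_uniq => /and3P[_ /hasPn nh uf] /=.
    rewrite (subseq_uniq sub uf) andbT; apply/negP => uin.
    by have := nh u (mem_subseq sub uin); rewrite uus.
  move/uniq_leq_size; apply=> w; rewrite inE => /orP[/eqP->|].
    rewrite mem_filter -(perm_mem pe) mem_cat uus /= andbT /R.
    by apply: leq_trans ge; lia.
  move=> wg; have wS : w \in S.
    by rewrite -(perm_mem pe) mem_cat (mem_subseq sub wg) orbT.
  rewrite mem_filter wS andbT.
  move/flatten_mapP: wg => [g]; rewrite mem_filter => /andP[lg gin] wg.
  have lti : index g gs < m by rewrite -sg index_mem.
  have := ac _ w lti; rewrite nth_index // => /(_ wg) [_ /(_ _ (imem _ wS) (iacc _ wS))].
  by rewrite /R; lia.
have grow k : k <= m -> k < count (R (m - k)) S.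
  elim: k => [|k IH] lek.
    rewrite subn0 -has_count; apply/hasP; exists u => //.
    by rewrite -(perm_mem pe) mem_cat uus.
  apply: (@leq_trans (c (m - k)).+1).
    by rewrite ltnS; apply: leq_trans (IH (ltnW lek)) (r_le_c _).
  by rewrite subnS; apply: c_lt_r; lia.
(* At k = m more than m slots are counted among m. *)
have := grow m (leqnn m); have := count_size (R (m - m)) S; rewrite sizeS; lia.
Qed.

(** While the queue is nonempty, each round raises the sum of the prices by one. A bidder takes a
    good no dearer than its partner in [ts], whose price is below m, so prices stay at most m and
    their sum at most m^2. *)
Lemma auction_complete ts : m * m < F -> matching ts -> (auctionF F x S items).1 = [::].
Proof.
move=> ltF mts.
suff H t : t <= F -> let st := iter t (bidF F x) st0 in
   (forall i, i < m -> price st.2 i <= m) /\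
   (st.1 = [::] \/ sumn (map fst st.2) = t).
  have := inv_iter (leqnn F); have [] := H F (leqnn F).
  rewrite /auctionF -/st0; case: (iter F _ st0) => us gs /= lem [//|e] [sg _ _ _ _].
  suff : sumn (map fst gs) <= size gs * m by rewrite e sg; lia.
  have : all (fun g : good => g.1 <= m) gs.
    by apply/(all_nthP d0) => i; rewrite sg; apply: lem.
  by elim: (gs) => //= g gs' IH /andP[le1 /IH]; rewrite mulSn; lia.
elim: t => [|t IH] ltt.
  have [sg _ lep _ _] := inv0; split=> [i lt|]; first exact: leq_trans (lep i lt) _.
  right; rewrite /= mapFE ?sizeitems // -map_comp.
  by elim: (items) => //= ? ? ->.
have [] := IH (ltnW ltt); have := inv_iter (ltnW ltt).
rewrite iterS; case: (iter t _ st0) => us gs iv /= lem alt.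
case: us iv alt => [|u us] iv alt; first by split=> //; left.
have [sg pe lep ow ac] := iv.
have uS : u \in S by rewrite -(perm_mem pe) mem_head.
have ltm := queued_price mts iv (mem_head u us).
have [pts ats] := mts.
have ui : index u ts < m by rewrite -sizeS -(perm_size pts) index_mem (perm_mem pts).
have au : nth false (acc u) (index u ts).
  by have := ats _ ui; rewrite nth_index // (perm_mem pts).
have [|[_ no]|[i [lti ai mini ->]]] := @bidFE u us gs sg (sizeacc uS).
- by move=> j lt; have := lep j lt; lia.
- by have := no _ ui; rewrite au.
have lti' : price gs i < m by apply: leq_ltn_trans ltm; apply: mini.
split=> [j lt|].
  by rewrite /= nth_set_nth /=; case: eqP => // _; apply: lem.
right; case: alt => // e.
have eg : gs = take i gs ++ nth d0 gs i :: drop i.+1 gs.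
  by rewrite -drop_nth ?sg // cat_take_drop.
rewrite /= set_nthE sg lti -e [in RHS]eg.
by rewrite !map_cat !sumn_cat /=; lia.
Qed.
End Auction.

Local Open Scope ring_scope.

(** * Bottleneck matchings and balanced allocations *)

Definition qfrac_of (u : rat) : qfrac := (nat_bits (absz (numq u)), nat_bits (absz (denq u))).

Lemma rat_le_frac (u : rat) (a b : nat) : 0 <= u ->
  (absz (numq u) * b <= a * absz (denq u))%N = (u * b%:R <= a%:R).
Proof.
move=> u0.
have dP : 0 < (absz (denq u))%:R :> rat by rewrite ltr0n absz_gt0 denq_neq0.
have eu : u = (absz (numq u))%:R / (absz (denq u))%:R.
  by rewrite -{1}(divq_num_den u) !pmulrn !gez0_abs ?numq_ge0 //.
rewrite [in RHS]eu mulrAC ler_pdivrMr // -!natrM ler_nat.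
by [].
Qed.

Lemma rat_le_cross (u u' : rat) : 0 <= u -> 0 <= u' ->
  (absz (numq u) * absz (denq u') <= absz (numq u') * absz (denq u))%N = (u <= u').
Proof.
move=> u0 u0'; rewrite rat_le_frac //.
have dP : 0 < (absz (denq u'))%:R :> rat by rewrite ltr0n absz_gt0 denq_neq0.
have eu : u' = (absz (numq u'))%:R / (absz (denq u'))%:R.
  by rewrite -{1}(divq_num_den u') !pmulrn !gez0_abs ?numq_ge0 //.
by rewrite [in RHS]eu ler_pdivlMr.
Qed.

Lemma card_count (T : finType) (P : pred T) : #|[set x | P x]| = count P (enum T).
Proof.
by rewrite -sum1_count big_enum_cond /= -sum1_card; apply: eq_bigl => x; rewrite inE.
Qed.

Lemma map_nth_ord T (d : T) m (s : seq T) : size s = m ->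
  [seq nth d s (val i) | i <- enum 'I_m] = s.
Proof.
by move=> <-; rewrite -[RHS](mkseq_nth d) /mkseq -val_enum_ord -map_comp.
Qed.

Section Model.
Variables (n m k : nat) (v : 'I_n -> 'I_m -> rat) (tau : 'I_n -> rat).
Hypotheses (n0 : (0 < n)%N) (mE : m = (k * n)%N).
Hypothesis tau01 : forall i, 0 <= tau i <= 1.

Definition picky i (j : nat) := tau i * k%:R <= j.+1%:R.

Definition mkslot (p : 'I_n * nat) : slot :=
  ((nat_bits p.1, nat_bits p.2),
   (picky p.1 p.2, [seq qfrac_of (v p.1 g) | g <- enum 'I_m])).

(** Reversed because [slotsF] collects slots by consing. *)
Definition ranks : seq ('I_n * nat) := rev [seq (i, j) | i <- enum 'I_n, j <- iota 0 k].

Definition all_slots := map mkslot ranks.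

Lemma mkslot_inj : injective mkslot.
Proof.
move=> [i j] [i' j'] [e1 e2 _ _].
by rewrite (nat_bits_inj e2); congr (_, _); apply/val_inj/nat_bits_inj.
Qed.

Lemma uniq_ranks : uniq ranks.
Proof.
rewrite rev_uniq; apply: allpairs_uniq; rewrite ?enum_uniq ?iota_uniq //.
by move=> [? ?] [? ?] _ _ [-> ->].
Qed.

Lemma size_ranks : size ranks = m.
Proof. by rewrite size_rev size_allpairs size_enum_ord size_iota mE mulnC. Qed.

Lemma mem_ranks i j : ((i, j) \in ranks) = (j < k)%N.
Proof.
rewrite mem_rev; apply/allpairsP/idP => [[[i' j'] [_ + [_ ->]]]|lt].
  by rewrite mem_iota.
by exists (i, j); rewrite mem_enum mem_iota.
Qed.

Lemma uniq_slots : uniq all_slots.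
Proof. by rewrite map_inj_uniq ?uniq_ranks //; apply: mkslot_inj. Qed.

Lemma size_slots : size all_slots = m.
Proof. by rewrite size_map size_ranks. Qed.

(** The quantile position counted from 0. The truncated predecessor sends quantile 0 to position 0,
    so both cases of [qvalue] are covered. *)
Definition pos i : nat := (absz (Num.ceil (tau i * k%:R))).-1.

Lemma ceil_nat i : (absz (Num.ceil (tau i * k%:R)))%:Z = Num.ceil (tau i * k%:R).
Proof.
have /andP[t0 _] := tau01 i.
rewrite gez0_abs // ceil_ge0; apply: lt_le_trans (mulr_ge0 t0 (ler0n _ _)).
by rewrite oppr_lt0.
Qed.

Lemma pickyE i j : picky i j = (pos i <= j)%N.
Proof.
rewrite /picky -[j.+1%:R]/((Posz j.+1)%:~R) -ceil_le_int -ceil_nat lez_nat /pos.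
by case: (absz _).
Qed.

Lemma pos_lt i : (0 < k)%N -> (pos i < k)%N.
Proof.
move=> k0; rewrite -(prednK k0) ltnS.
rewrite -pickyE /picky prednK //.
have /andP[_ t1] := tau01 i.
by rewrite -{2}[k%:R]mul1r ler_wpM2r.
Qed.

Lemma size_sorted (S : {set 'I_m}) i : size (sorted_values (v i) S) = #|S|.
Proof. by rewrite /sorted_values size_sort size_image. Qed.

Lemma qvalueE i (S : {set 'I_m}) : #|S| = k ->
  qvalue (v i) (tau i) S = nth 0 (sorted_values (v i) S) (pos i).
Proof.
move=> cS; rewrite /qvalue cS -/(pos i); case: ltP => // t0.
have /andP[t0' _] := tau01 i.
have -> : pos i = 0%N; last by [].
by rewrite /pos (le_anti (introT andP (conj t0 t0'))) mul0r ceil0.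
Qed.

Definition accepts (x : rat) (p : 'I_n * nat) (g : 'I_m) := picky p.1 p.2 ==> (x <= v p.1 g).

Lemma count_ranks i b : count (fun p : 'I_n * nat => (p.1 == i) && (p.2 < b)%N) ranks = minn k b.
Proof.
rewrite count_rev count_flatten -map_comp.
have -> : minn k b = (\sum_(i' <- enum 'I_n) (i' == i) * minn k b)%N.
  rewrite (bigD1_seq i) ?mem_enum ?enum_uniq //= eqxx mul1n big1 ?addn0 //.
  by move=> i' /negbTE ->.
rewrite sumnE big_map; apply: eq_bigr => i' _ /=.
rewrite count_map; case: (eqVneq i' i) => [->|ne]; last first.
  rewrite mul0n (eq_count (a2 := pred0)) ?count_pred0 // => j /=.
  by rewrite (negbTE ne).
rewrite mul1n (eq_count (a2 := fun j => (j < b)%N)); last by move=> j /=; rewrite eqxx.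
elim: (k) => [|k' IH]; first by rewrite min0n.
rewrite -addn1 iotaD count_cat IH /= !add0n addn0 /=.
by case: ltnP; lia.
Qed.

Definition alloc_of (ps : seq ('I_n * nat)) : allocation n m :=
  [ffun g : 'I_m => (nth (Ordinal n0, 0%N) ps g).1].

(** Distinct goods of an agent sit in distinct slots of that agent. Applied with [p.2 < k] to bound
    bundles and with [p.2 < pos i] to bound the goods below the threshold. *)
Lemma card_alloc_of ps i (P : 'I_m -> bool) (Q : 'I_n * nat -> bool) : perm_eq ps ranks ->
  (forall g : 'I_m, alloc_of ps g = i -> P g -> Q (nth (Ordinal n0, 0%N) ps g)) ->
  (#|[set g | (alloc_of ps g == i) && P g]| <= count (fun p => (p.1 == i) && Q p) ranks)%N.
Proof.
move=> pe PQ; rewrite -(permP pe).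
have sps : size ps = m by rewrite (perm_size pe) size_ranks.
rewrite -[X in (_ <= count _ X)%N](map_nth_ord (Ordinal n0, 0%N) sps) count_map.
rewrite card_count; apply: sub_count => g /= /andP[/eqP e Pg].
by rewrite (PQ g e Pg) andbT -e ffunE.
Qed.

Lemma balanced_alloc_of ps : perm_eq ps ranks -> balanced k (alloc_of ps).
Proof.
move=> pe.
have le i : (#|bundle (alloc_of ps) i| <= k)%N.
  have := @card_alloc_of ps i xpredT (fun p => p.2 < k)%N pe.
  rewrite count_ranks minnn => H.
  apply: leq_trans (H _); last first.
    move=> g _ _; have : nth (Ordinal n0, 0%N) ps g \in ranks.
      by rewrite -(perm_mem pe) mem_nth // (perm_size pe) size_ranks.
    by case: (nth _ _ _) => i' j'; rewrite mem_ranks.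
  by apply/subset_leq_card/subsetP => g; rewrite !inE andbT.
(* No bundle exceeds k and the sizes add up to k n, so all inequalities are equalities. *)
have sum : (\sum_(i < n) #|bundle (alloc_of ps) i| = \sum_(i < n) k)%N.
  rewrite sum_nat_const card_ord mulnC -mE -[in RHS](card_ord m).
  rewrite -sum1_card (partition_big (alloc_of ps) xpredT) //=.
  apply: eq_bigr => i _; rewrite -sum1_card; apply: eq_bigl => g.
  by rewrite inE.
move=> i; apply/eqP; have := leqif_sum (fun i (_ : xpredT i) => leqif_eq (le i)).
by rewrite sum => -[_]; rewrite eqxx => /esym/forallP/(_ i).
Qed.

(** Goods below the threshold can only sit in slots that are not picky, of which the agent has at
    most [pos i]; hence entry [pos i] of the sorted bundle is not below it. *)
Lemma matching_alloc x ps : perm_eq ps ranks ->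
  (forall g : 'I_m, accepts x (nth (Ordinal n0, 0%N) ps g) g) -> (0 < k)%N ->
  forall i, x <= qvalue (v i) (tau i) (bundle (alloc_of ps) i).
Proof.
move=> pe ac k0 i; have bal := balanced_alloc_of pe i.
rewrite qvalueE //; set S := bundle _ _ in bal *.
apply: nth_count_ge; first exact/sort_sorted/le_total.
rewrite size_sorted bal pos_lt // andbT.
rewrite /sorted_values (permP (permEl (perm_sort _ _))) /image_mem count_map.
have -> : count (preim (v i) (< x)) (enum S) =
    #|[set g | (alloc_of ps g == i) && (v i g < x)]|.
  rewrite -sum1_count big_enum_cond /= -sum1_card.
  by apply: eq_bigl => g; rewrite !inE.
apply: leq_trans (card_alloc_of (Q := fun p => p.2 < pos i)%N pe _) _; last first.
  by rewrite count_ranks geq_minr.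
move=> g e lt; rewrite ltnNge -pickyE; apply/negP => pk.
have := ac g; rewrite /accepts; move: e; rewrite /alloc_of ffunE => ->.
by rewrite pk /= leNgt lt.
Qed.

(** A good is matched to the slot of its owner indexed by the rank of the good in the sorted bundle.
    Picky slots have rank at least [pos], where values are no smaller than the quantile value. *)
Lemma alloc_matching x (B : allocation n m) : balanced k B ->
  (forall i, x <= qvalue (v i) (tau i) (bundle B i)) ->
  exists2 ps, perm_eq ps ranks &
    forall g : 'I_m, accepts x (nth (Ordinal n0, 0%N) ps g) g.
Proof.
move=> bal xle.
pose s i := sort (relpre (v i) <=%R) (enum (bundle B i)).
have ss i : sorted_values (v i) (bundle B i) = map (v i) (s i).
  by rewrite /sorted_values /image_mem sort_map.
have sz i : size (s i) = k by rewrite size_sort -cardE bal.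
have ms i g : (g \in s i) = (B g == i) by rewrite mem_sort mem_enum inE.
pose f g := (B g, index g (s (B g))).
have fk g : (index g (s (B g)) < k)%N by rewrite -(sz (B g)) index_mem ms.
exists (map f (enum 'I_m)).
  have uf : uniq (map f (enum 'I_m)).
    rewrite map_inj_uniq ?enum_uniq // => g g' [e1 e2].
    have gs : g \in s (B g) by rewrite ms.
    by rewrite -(nth_index g gs) e2 e1 nth_index // ms.
  apply: uniq_perm => //; first exact: uniq_ranks.
  have sub : {subset map f (enum 'I_m) <= ranks}.
    by move=> p /mapP[g _ ->]; rewrite mem_ranks fk.
  have [|_] := uniq_min_size uf sub; last by [].
  by rewrite size_ranks size_map size_enum_ord.
move=> g; rewrite (nth_map g) ?size_enum_ord // nth_ord_enum /accepts /=.
apply/implyP; rewrite pickyE => lep.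
apply: le_trans (xle (B g)) _; rewrite qvalueE // ss.
have -> : v (B g) g = nth 0 (map (v (B g)) (s (B g))) (index g (s (B g))).
  by rewrite (nth_map g) ?sz // nth_index // ms.
apply: (le_sorted_leq_nth) => //.
- by rewrite -ss; apply/sort_sorted/le_total.
- by rewrite inE size_map sz (leq_ltn_trans lep).
- by rewrite inE size_map sz.
Qed.

Lemma ESW_le (A : allocation n m) i : ESW v tau A <= qvalue (v i) (tau i) (bundle A i).
Proof.
rewrite /ESW; set s := map _ _.
have : qvalue (v i) (tau i) (bundle A i) \in s by apply: map_f; rewrite mem_enum.
elim: s (head 0 s) => //= y s IH d; rewrite inE => /orP[/eqP ->|/IH le].
  by rewrite ge_min lexx.
by rewrite ge_min le orbT.
Qed.

Lemma ESW_mem (A : allocation n m) : exists i, ESW v tau A = qvalue (v i) (tau i) (bundle A i).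
Proof.
rewrite /ESW; set s := map _ _.
have sN : s != [::] by rewrite -size_eq0 size_map size_enum_ord -lt0n.
suff : foldr Num.min (head 0 s) s \in s by move=> /mapP[i _ ->]; exists i.
have hd : head 0 s \in s by case: (s) sN => //= y s' _; rewrite mem_head.
have gen t : {subset t <= s} -> foldr Num.min (head 0 s) t \in s.
  elim: t => //= y t IH sub.
  have ys : y \in s by apply: sub; rewrite mem_head.
  have ts : foldr Num.min (head 0 s) t \in s.
    by apply: IH => z zt; apply: sub; rewrite inE zt orbT.
  by rewrite /Num.min; case: ifP.
exact: gen.
Qed.

(** The reason why the values of single goods suffice as candidate thresholds. *)
Lemma qvalue_mem i (S : {set 'I_m}) : (0 < k)%N -> #|S| = k ->
  exists g, qvalue (v i) (tau i) S = v i g.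
Proof.
move=> k0 cS; rewrite qvalueE //.
have : nth 0 (sorted_values (v i) S) (pos i) \in sorted_values (v i) S.
  by rewrite mem_nth // size_sorted cS pos_lt.
by rewrite mem_sort => /imageP[g _ ->]; exists g.
Qed.
End Model.

(** * Correctness of the program *)

Definition rat_tokens (u : rat) : seq bits :=
  [:: [:: numq u < 0]; nat_bits (absz (numq u)); [:: denq u < 0]; nat_bits (absz (denq u))].

Lemma fieldsD s t : fields (s ++ t) = fields s ++ fields t.
Proof. by rewrite /fields map_cat flatten_cat. Qed.

Lemma enc_rat_fields us : flatten (map enc_rat us) = fields (flatten (map rat_tokens us)).
Proof.
elim: us => [//|u us IH].
transitivity (enc_rat u ++ fields (flatten (map rat_tokens us))); first by rewrite -IH.
rewrite -[enc_rat u](_ : fields (rat_tokens u) = _) -?fieldsD //.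
by rewrite /enc_rat /enc_int /enc_nat /fields /= cats0.
Qed.

Lemma foldl_rev_emit (o b : bits) :
  foldl (fun (o : bits) (b : bool) => b :: true :: o) o b =
  rev (flatten [seq [:: true; c] | c <- b]) ++ o.
Proof. by elim: b o => //= c b IH o; rewrite IH !rev_cons !cat_rcons. Qed.

Lemma outputFE F (gs : seq good) ts : (size gs <= F)%N ->
  (forall u, u \in ts -> size u.1.1 <= F)%N ->
  map snd gs = [seq [:: u] | u <- ts] ->
  outputF F gs = rev (flatten [seq field u.1.1 | u <- ts]).
Proof.
move=> le leu egs; rewrite /outputF foldFE //; set f := (X in foldl X).
suff H o : (forall u, u \in ts -> size u.1.1 <= F)%N ->
   map snd gs = [seq [:: u] | u <- ts] ->
   foldl f o gs = rev (flatten [seq field u.1.1 | u <- ts]) ++ o.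
  by rewrite H // cats0.
elim: gs ts o {le leu egs} => [|g gs IH] [|u ts] //= o leu [eg egs].
have -> : f o g = rev (field u.1.1) ++ o.
  rewrite /f eg foldFE; last by apply: leu; rewrite mem_head.
  by rewrite foldl_rev_emit /field rev_cat.
rewrite (IH ts) //; first by rewrite rev_cat catA.
by move=> w wts; apply: leu; rewrite inE wts orbT.
Qed.

Section Correct.
Variables (n m k : nat) (v : 'I_n -> 'I_m -> rat) (tau : 'I_n -> rat).
Hypotheses (n0 : (0 < n)%N) (mE : m = (k * n)%N).
Hypotheses (v0 : forall i g, 0 <= v i g) (tau01 : forall i, 0 <= tau i <= 1).

Let taus := [seq tau i | i <- enum 'I_n].
Let vals := flatten [seq [seq v i g | g <- enum 'I_m] | i <- enum 'I_n].
Let tokens := nat_bits n :: nat_bits m :: nat_bits k ::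
  flatten (map rat_tokens (taus ++ vals)).
Let N := size (enc_instance k v tau).
Let F := (N * N)%N.

Lemma enc_instance_fields : enc_instance k v tau = fields tokens.
Proof.
rewrite /enc_instance /tokens -[RHS]/(enc_nat n ++ enc_nat m ++ enc_nat k ++ fields _).
congr (_ ++ (_ ++ (_ ++ _))); rewrite -enc_rat_fields map_cat flatten_cat.
congr (_ ++ _); first by rewrite /taus -map_comp.
rewrite /vals; elim: (enum 'I_n) => //= i s IH.
by rewrite map_cat flatten_cat -IH -map_comp.
Qed.

Lemma size_vals : size vals = (n * m)%N.
Proof.
rewrite size_flatten /shape -map_comp.
rewrite (eq_map (g := fun=> m)); last by move=> i /=; rewrite size_map size_enum_ord.
by rewrite sumnE big_map big_const_seq count_predT size_enum_ord iter_addn_0 mulnC.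
Qed.

(** A token takes at least the two bits of its terminator. There are four tokens for each of the n +
    n m rationals and three for the dimensions. *)
Lemma size_tokens : (8 * (n + n * m) + 6 <= N)%N.
Proof.
rewrite /N enc_instance_fields; apply: leq_trans (size_fields_count tokens).
rewrite /tokens /= size_flatten /shape -map_comp.
rewrite (eq_map (g := fun=> 4%N)); last by [].
rewrite sumnE big_map big_const_seq count_predT iter_addn_0 size_cat size_vals.
by rewrite /taus size_map size_enum_ord; lia.
Qed.

Lemma size_token t : t \in tokens -> (size t <= N)%N.
Proof. by rewrite /N enc_instance_fields; apply: size_fields_ge. Qed.

Lemma mem_rat_token u t : u \in taus ++ vals -> t \in rat_tokens u -> t \in tokens.
Proof.
move=> uin tu; rewrite /tokens !inE; apply/orP; right; apply/orP; right; apply/orP; right.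
by apply/flatten_mapP; exists u.
Qed.

Lemma size_num u : u \in taus ++ vals -> (size (nat_bits (absz (numq u))) <= N)%N.
Proof. by move=> uin; apply/size_token/(mem_rat_token uin); rewrite !inE eqxx !orbT. Qed.

Lemma size_den u : u \in taus ++ vals -> (size (nat_bits (absz (denq u))) <= N)%N.
Proof. by move=> uin; apply/size_token/(mem_rat_token uin); rewrite !inE eqxx !orbT. Qed.

Lemma size_n : (size (nat_bits n) <= N)%N.
Proof. by apply: size_token; rewrite !inE eqxx. Qed.
Lemma size_m : (size (nat_bits m) <= N)%N.
Proof. by apply: size_token; rewrite !inE eqxx orbT. Qed.
Lemma size_k : (size (nat_bits k) <= N)%N.
Proof. by apply: size_token; rewrite !inE eqxx !orbT. Qed.

(** The dimensions are written in binary, yet they are at most N, because n m values and n quantiles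
    are listed and k <= m <= n m. *)
Lemma fuel_bounds : (m * m < F /\ N < F /\ N + N <= F /\ m <= N /\ n <= N /\ k <= N)%N.
Proof.
have := size_tokens; have le1 : (m <= n * m)%N by rewrite leq_pmull.
have le2 : (k <= m)%N by rewrite mE leq_pmulr.
move: (n * m)%N le1 => nm le1 leN; rewrite /F.
have mN : (m < N)%N by lia.
have N2 : (2 <= N)%N by lia.
split; first by rewrite ltn_mul.
by split; [|split; [|lia]]; nia.
Qed.

Lemma val_in i g : v i g \in vals.
Proof.
by apply/flatten_mapP; exists i; rewrite ?mem_enum //; apply: map_f; rewrite mem_enum.
Qed.

Lemma tau_in i : tau i \in taus ++ vals.
Proof. by rewrite mem_cat map_f ?mem_enum. Qed.

Lemma rats_ge0 u : u \in taus ++ vals -> 0 <= u.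
Proof.
rewrite mem_cat => /orP[/mapP[i _ ->]|/flatten_mapP[i _ /mapP[g _ ->]]] //.
by have /andP[] := tau01 i.
Qed.

Lemma leqfrac_rat u u' : u \in taus ++ vals -> u' \in taus ++ vals ->
  leqfracF F (qfrac_of u) (qfrac_of u') = (u <= u').
Proof.
move=> uin uin'; have [_ [_ [N2 _]]] := fuel_bounds.
have := size_num uin; have := size_den uin; have := size_num uin'; have := size_den uin'.
move=> *; rewrite leqfracFE /=; try lia.
by rewrite !bval_nat_bits rat_le_cross //; apply: rats_ge0.
Qed.

Lemma leqfrac_rank i j : (j < k)%N ->
  leqfracF F (qfrac_of (tau i)) (incF F (nat_bits j), nat_bits k) = picky k tau i j.
Proof.
move=> ltj; have [_ [NF [N2 _]]] := fuel_bounds.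
have := size_num (tau_in i); have := size_den (tau_in i); have := size_k => lek *.
have sj : (size (nat_bits j.+1) <= N)%N.
  by apply: leq_trans lek; apply: size_nat_bits_le.
have sj' : (size (nat_bits j) <= N)%N.
  by apply: leq_trans sj; apply: size_nat_bits_le.
rewrite incFE; last by apply: leq_ltn_trans NF.
rewrite -nat_bits_succ leqfracFE /=; try lia.
rewrite !bval_nat_bits rat_le_frac //.
by have /andP[] := tau01 i.
Qed.

Lemma iota_enum q : (q <= N)%N -> (size (nat_bits q) <= N)%N ->
  iotaF F (nat_bits q) = [seq nat_bits i | i : 'I_q <- enum 'I_q].
Proof.
move=> leq les; have [_ [NF _]] := fuel_bounds.
rewrite iotaFE; [|lia|lia].
by rewrite -val_enum_ord -map_comp.
Qed.

Let items := [seq nat_bits i | i : 'I_m <- enum 'I_m].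

Lemma slotsFE : slotsF F (nat_bits n) (nat_bits m) (nat_bits k)
   (map qfrac_of taus) (map qfrac_of vals) = all_slots k v tau.
Proof.
have [_ [NF [_ [leM [leN leK]]]]] := fuel_bounds.
have sI : (size items <= F)%N by rewrite /items size_map size_enum_ord; lia.
rewrite /slotsF (iota_enum leN size_n) (iota_enum leM size_m).
rewrite iotaFE; [|by apply: leq_ltn_trans NF; exact: size_k|lia].
rewrite foldFE; last by rewrite size_map size_enum_ord; lia.
set f := (X in foldl X).
have fE t ts vs o b : f ((t :: ts, vs), o) b =
    ((ts, drop m vs), foldl (fun s j =>
       ((b, j), (leqfracF F t (incF F j, nat_bits k), take m vs)) :: s) o
       [seq nat_bits j | j <- iota 0 k]).
  transitivity (let r := chunkF F items vs in ((ts, r.2), foldF F (fun s j =>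
       ((b, j), (leqfracF F t (incF F j, nat_bits k), r.1)) :: s) o
       [seq nat_bits j | j <- iota 0 k])); first by [].
  rewrite (chunkFE _ sI) {1 2}/items size_map size_enum_ord; cbv zeta.
  rewrite foldFE //.
  by rewrite size_map size_iota; lia.
rewrite /all_slots /ranks map_rev /taus /vals -map_comp.
suff H out : (foldl f ([seq (qfrac_of \o tau) i | i <- enum 'I_n],
    map qfrac_of (flatten [seq [seq v i g | g <- enum 'I_m] | i <- enum 'I_n]), out)
    [seq nat_bits i | i : 'I_n <- enum 'I_n]).2 =
  rev (map (mkslot k v tau) [seq (i, j) | i <- enum 'I_n, j <- iota 0 k]) ++ out.
  by rewrite H cats0.
elim: (enum 'I_n) out => //= i s IH out.
rewrite fE !map_cat.
have sr : size (map qfrac_of [seq v i g | g <- enum 'I_m]) = m.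
  by rewrite 2!size_map size_enum_ord.
rewrite take_size_cat // drop_size_cat // IH rev_cat -catA; congr (_ ++ _).
have sub : {subset iota 0 k <= [pred j | (j < k)%N]}.
  by move=> j; rewrite mem_iota.
elim: (iota 0 k) sub out {IH} => //= j js IHj sub out.
rewrite leqfrac_rank; last by apply: sub; rewrite mem_head.
rewrite IHj; last by move=> j' j'in; apply: sub; rewrite inE j'in orbT.
rewrite rev_cons cat_rcons; congr (_ ++ (_, (_, _)) :: _).
by rewrite -map_comp.
Qed.

Let run (x : rat) := auctionF F (qfrac_of x) (all_slots k v tau) items.

Lemma acceptFE x p : x \in vals ->
  acceptF F (qfrac_of x) (mkslot k v tau p) =
  [seq accepts k v tau x p g | g <- enum 'I_m].
Proof.
move=> xin; have [_ [NF [_ [leM _]]]] := fuel_bounds.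
rewrite /acceptF mapFE /=; last by rewrite size_map size_enum_ord; lia.
rewrite -map_comp; apply: eq_map => g /=; rewrite /accepts.
case: (picky _ _ _ _) => //=; apply: leqfrac_rat; rewrite mem_cat ?xin ?orbT //.
by rewrite val_in orbT.
Qed.

Lemma size_acceptF x u : x \in vals -> u \in all_slots k v tau ->
  size (acceptF F (qfrac_of x) u) = m.
Proof.
by move=> xin /mapP[p _ ->]; rewrite acceptFE // size_map size_enum_ord.
Qed.

Lemma size_items : size items = m.
Proof. by rewrite size_map size_enum_ord. Qed.

Lemma run_sound x : x \in vals -> (run x).1 = [::] ->
  exists ps, [/\ perm_eq ps (ranks n k),
     forall g : 'I_m, accepts k v tau x (nth (Ordinal n0, 0%N) ps g) g &
     map snd (run x).2 = [seq [:: mkslot k v tau p] | p <- ps]].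
Proof.
move=> xin run0; have [_ [NF [_ [leM _]]]] := fuel_bounds.
have mF : (m <= F)%N by lia.
have [ts [pts ats] ets] := auction_sound (uniq_slots k v tau) (size_slots v tau mE) mF
    (fun u => @size_acceptF x u xin) size_items run0.
(* The permutation of slots is expressed through indices, which lift it to a permutation of
   [ranks]. *)
have /(perm_iotaP (mkslot k v tau (Ordinal n0, 0%N)))[Is pIs eIs] := pts.
rewrite /all_slots size_map in pIs.
pose ps := map (nth (Ordinal n0, 0%N) (ranks n k)) Is.
have pps : perm_eq ps (ranks n k).
  by apply/(perm_iotaP (Ordinal n0, 0%N)); exists Is.
have eps : ts = map (mkslot k v tau) ps.
  rewrite eIs /ps -map_comp; apply/eq_in_map => i.
  by rewrite (perm_mem pIs) mem_iota => lti; rewrite /= (nth_map (Ordinal n0, 0%N)).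
exists ps; split=> //; last by rewrite ets eps -map_comp.
move=> g; have := ats g (ltn_ord g).
have ltg : (g < size ps)%N by rewrite (perm_size pps) (size_ranks mE).
rewrite eps (nth_map (Ordinal n0, 0%N)) // acceptFE // (nth_map g) ?size_enum_ord //.
by rewrite nth_ord_enum.
Qed.

Lemma run_complete x ps : x \in vals -> perm_eq ps (ranks n k) ->
  (forall g : 'I_m, accepts k v tau x (nth (Ordinal n0, 0%N) ps g) g) ->
  (run x).1 = [::].
Proof.
move=> xin pps aps; have [mmF [NF [_ [leM _]]]] := fuel_bounds.
have mF : (m <= F)%N by lia.
apply: (auction_complete (ts := map (mkslot k v tau) ps) (uniq_slots k v tau)
  (size_slots v tau mE) mF (fun u => @size_acceptF x u xin) size_items mmF).
split=> [|g ltg]; first exact: perm_map.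
have ltg' : (g < size ps)%N by rewrite (perm_size pps) (size_ranks mE).
rewrite (nth_map (Ordinal n0, 0%N)) // acceptFE //.
rewrite (nth_map (Ordinal ltg)) ?size_enum_ord //.
have -> : nth (Ordinal ltg) (enum 'I_m) g = Ordinal ltg.
  by rewrite -[X in nth _ _ X]/(val (Ordinal ltg)) nth_ord_enum.
exact: (aps (Ordinal ltg)).
Qed.

Lemma bestFE :
  (bestF F (all_slots k v tau) items (map qfrac_of vals) = [::] /\
     forall x, x \in vals -> (run x).1 != [::]) \/
  exists x, [/\ x \in vals, (run x).1 = [::],
     bestF F (all_slots k v tau) items (map qfrac_of vals) = [:: (qfrac_of x, (run x).2)] &
     forall x', x' \in vals -> (run x').1 = [::] -> x' <= x].
Proof.
have [_ [NF _]] := fuel_bounds.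
rewrite /bestF foldFE; last first.
  by rewrite size_map size_vals; have := size_tokens; lia.
set f := (X in foldl X).
have fE b x : f b (qfrac_of x) =
   if nilp (run x).1 && (match b with [::] => true | y :: _ => leqfracF F y.1 (qfrac_of x) end)
   then [:: (qfrac_of x, (run x).2)] else b by [].
suff gen s : {subset s <= vals} ->
  (foldl f [::] (map qfrac_of s) = [::] /\ forall x, x \in s -> (run x).1 != [::]) \/
  exists x, [/\ x \in s, (run x).1 = [::],
     foldl f [::] (map qfrac_of s) = [:: (qfrac_of x, (run x).2)] &
     forall x', x' \in s -> (run x').1 = [::] -> x' <= x] by exact: gen.
elim/last_ind: s => [|s x IH] sub; first by left.
have xin : x \in vals by apply: sub; rewrite mem_rcons mem_head.
have subs : {subset s <= vals} by move=> y ys; apply: sub; rewrite mem_rcons inE ys orbT.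
rewrite map_rcons foldl_rcons.
have [[-> no]|[y [ys ry -> ymax]]] := IH subs; rewrite fE.
  rewrite andbT /nilp; have [r0|rN] := eqVneq (run x).1 [::].
    right; exists x; rewrite r0; split=> //; first by rewrite mem_rcons mem_head.
    by move=> x'; rewrite mem_rcons inE => /orP[/eqP ->|/no/eqP].
  left; rewrite size_eq0 (negbTE rN); split=> // x'.
  by rewrite mem_rcons inE => /orP[/eqP -> //|/no].
have inr u : u \in vals -> u \in taus ++ vals by rewrite mem_cat orbC => ->.
rewrite /= (leqfrac_rat (inr _ (subs _ ys)) (inr _ xin)) /nilp; have [r0|rN] := eqVneq (run x).1 [::].
  rewrite r0 /=; have [leyx|ltxy] := leP y x.
    right; exists x; split=> //; first by rewrite mem_rcons mem_head.
    move=> x'; rewrite mem_rcons inE => /orP[/eqP ->|x's r']; first by [].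
    exact: le_trans (ymax x' x's r') leyx.
  right; exists y; split=> //; first by rewrite mem_rcons inE ys orbT.
  move=> x'; rewrite mem_rcons inE => /orP[/eqP -> _|]; last exact: ymax.
  exact: ltW.
rewrite size_eq0 (negbTE rN) /=; right; exists y; split=> //.
  by rewrite mem_rcons inE ys orbT.
move=> x'; rewrite mem_rcons inE => /orP[/eqP -> r'|]; last exact: ymax.
by rewrite r' eqxx in rN.
Qed.

Lemma solveFE : exists A : allocation n m,
  [/\ balanced k A, forall B, balanced k B -> ESW v tau B <= ESW v tau A &
   solveF F (nat_bits n) (nat_bits m) (nat_bits k) (map qfrac_of (taus ++ vals)) =
   rev (enc_alloc A)].
Proof.
have [_ [NF [_ [leM [leN leK]]]]] := fuel_bounds.
have -> : solveF F (nat_bits n) (nat_bits m) (nat_bits k) (map qfrac_of (taus ++ vals)) =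
    match bestF F (all_slots k v tau) items (map qfrac_of vals) with
    | [::] => [::] | y :: _ => outputF F y.2 end.
  rewrite /solveF (iota_enum leN size_n) (iota_enum leM size_m) chunkFE; last first.
    by rewrite size_map size_enum_ord; lia.
  rewrite map_cat size_map size_enum_ord.
  have st : size (map qfrac_of taus) = n by rewrite 2!size_map size_enum_ord.
  by rewrite take_size_cat // drop_size_cat // -slotsFE.
(* Without goods there is no candidate threshold, although the only allocation has the default
   welfare 0; the empty output encodes it. *)
have [k0|kP] := posnP k.
  have m0 : m = 0%N by rewrite mE k0.
  have e0 : enum 'I_m = [::] by apply: size0nil; rewrite size_enum_ord.
  have noI (g : 'I_m) : False by have := leq_ltn_trans (leq0n _) (ltn_ord g); rewrite m0.
  exists (alloc_of m n0 [::]); split.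
  - by move=> i; rewrite k0; apply/eqP; rewrite cards_eq0; apply/eqP/setP => g; case: (noI g).
  - by move=> B _; rewrite (_ : B = alloc_of m n0 [::]) //; apply/ffunP => g; case: (noI g).
  have -> : vals = [::] by apply: size0nil; rewrite size_vals m0 muln0.
  by rewrite /enc_alloc e0 /bestF foldFE.
(* The welfare of any balanced allocation is a candidate at which the auction succeeds, so the
   largest successful candidate is an upper bound for all of them. *)
have opt B : balanced k B -> exists2 x, x \in vals & x = ESW v tau B /\ (run x).1 = [::].
  move=> bB; have [i ei] := ESW_mem v tau n0 B.
  have [g eg] := qvalue_mem v tau01 i kP (bB i).
  have xin : ESW v tau B \in vals by rewrite ei eg val_in.
  exists (ESW v tau B) => //; split=> //.
  have [ps pps aps] := alloc_matching n0 mE tau01 bB (ESW_le v tau B).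
  exact: run_complete xin pps aps.
have [[_ no]|[x [xin rx -> xmax]]] := bestFE.
  (* Handing out the goods in the order of [ranks] is balanced, so some candidate must succeed. *)
  have [x xin [_ rx]] := opt _ (balanced_alloc_of n0 mE (perm_refl (ranks n k))).
  by have := no x xin; rewrite rx.
have [ps [pps aps eps]] := run_sound xin rx.
exists (alloc_of m n0 ps); split.
- exact: balanced_alloc_of.
- move=> B bB; have [x' x'in [<- rx']] := opt B bB.
  apply: le_trans (xmax x' x'in rx') _.
  have [i ->] := ESW_mem v tau n0 (alloc_of m n0 ps).
  exact: (matching_alloc mE tau01 pps aps kP).
have sps : size ps = m by rewrite (perm_size pps) (size_ranks mE).
rewrite (outputFE (ts := map (mkslot k v tau) ps)).
- rewrite -map_comp /enc_alloc; congr (rev (flatten _)).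
  rewrite -[in LHS](map_nth_ord (Ordinal n0, 0%N) sps) -map_comp.
  by apply: eq_map => g; rewrite /= /alloc_of ffunE.
- by rewrite -(size_map snd) eps size_map sps; lia.
- move=> u /mapP[p pin ->] /=; apply: leq_trans (ltnW NF).
  apply: leq_trans size_n; apply: size_nat_bits_le.
  exact: ltnW (ltn_ord p.1).
- by rewrite eps -map_comp.
Qed.

Lemma programFE : exists A : allocation n m,
  [/\ balanced k A, forall B, balanced k B -> ESW v tau B <= ESW v tau A &
   programF F (rev (enc_instance k v tau)) = rev (enc_alloc A)].
Proof.
have [A [bA oA eA]] := solveFE; exists A; split=> //; rewrite -eA.
have [_ [NF _]] := fuel_bounds.
have sw : (size (enc_instance k v tau) <= F)%N by apply: ltnW.
rewrite /programF revFE ?size_rev // revK enc_instance_fields tokensFE -?enc_instance_fields //.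
rewrite /tokens /=; congr solveF.
pose gs := [seq (([:: numq u < 0], qfrac_of u), [:: denq u < 0]) | u <- taus ++ vals].
have -> : flatten [seq rat_tokens i | i <- taus ++ vals] =
   flatten [seq [:: g.1.1; g.1.2.1; g.2; g.1.2.2] | g <- gs].
  by rewrite -map_comp.
rewrite fracsFE; first by rewrite -map_comp.
rewrite size_map size_cat size_vals /taus size_map size_enum_ord.
by have := size_tokens; lia.
Qed.

Lemma size_enc_alloc (A : allocation n m) :
  (size (enc_alloc A) <= N.+2 * N.+2)%N.
Proof.
have [_ [_ [_ [leM _]]]] := fuel_bounds.
rewrite /enc_alloc size_flatten /shape -map_comp sumnE big_map.
apply: (@leq_trans (\sum_(g <- enum 'I_m) N.*2.+2)%N).
  apply: leq_sum => g _; rewrite /= /enc_nat size_field.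
  have : (size (nat_bits (A g)) <= N)%N.
    by apply: leq_trans size_n; apply/size_nat_bits_le/ltnW/ltn_ord.
  lia.
rewrite big_const_seq count_predT size_enum_ord iter_addn_0.
have := size_tokens; have : (m <= n * m)%N by rewrite leq_pmull.
by move: (n * m)%N => nm le1 le2; nia.
Qed.
End Correct.

(* There is a Turing machine M and a degree d such that on every instance
   (n >= 1 agents, m = k n goods, nonnegative values, quantiles in [0,1])
   M halts within (input length + 2)^d steps and outputs a balanced
   allocation whose ESW is maximum among all balanced allocations. *)
Theorem theorem3 :
  exists (M : TM) (d : nat),
  forall (n m k : nat) (v : 'I_n -> 'I_m -> rat) (tau : 'I_n -> rat),
    (0 < n)%N ->
    m = (k * n)%N ->
    (forall i g, 0 <= v i g) ->
    (forall i, 0 <= tau i <= 1) ->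
    exists A : allocation n m,
      [/\ balanced k A,
          (forall B : allocation n m, balanced k B -> ESW v tau B <= ESW v tau A)
        & tm_computes_within M ((size (enc_instance k v tau)).+2 ^ d)%N
            (enc_instance k v tau) (enc_alloc A)].
Proof.
have [e he] := comp_programF; have [M [d hM]] := exp_computable e.
exists M, d => n m k v tau n0 mE v0 tau01.
have [A [bA oA eA]] := programFE n0 mE v0 tau01.
exists A; split=> //; apply: hM; last exact: size_enc_alloc.
by have := he (size (enc_instance k v tau)) (rev (enc_instance k v tau)); rewrite eA.
Qed.
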